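(* Let $c_\alpha,c_z\ge0$, $\ell_c>0$, $\ell_J,\tilde\ell_J\ge0$ and $c_0>0$ be constants. Assume that $A$ is bounded and: (i) $|b(\alpha,z)-b(\alpha',z')|^2\le c_\alpha|\alpha-\alpha'|^2+c_z|z-z'|^2$ for all $(\alpha,z),(\alpha',z')\in A\times\mathbb{R}$, and $\mathbb{E}[\xi_0^2]<\infty$; (ii) $|\tilde{\mathcal{J}}(\alpha,\nu')-\tilde{\mathcal{J}}(\alpha,\nu)|\le\tilde\ell_J W_2(\nu,\nu')$ for all $\alpha\in A$, $\nu,\nu'\in\mathcal{K}$; (iii) for each $z\in\mathbb{R}$, $\alpha\mapsto\mathcal{J}(\alpha,z)$ is continuously differentiable on $A$ and, for all $\alpha,\alpha'\in A$, $z\in\mathbb{R}$, $\epsilon\in[0,1]$, $\mathcal{J}(\epsilon\alpha+(1-\epsilon)\alpha',z)\le\epsilon\mathcal{J}(\alpha,z)+(1-\epsilon)\mathcal{J}(\alpha',z)-\frac{\ell_c}{2}\epsilon(1-\epsilon)|\alpha-\alpha'|^2$; and $|\partial_\alpha\mathcal{J}(\alpha,z')-\partial_\alpha\mathcal{J}(\alpha,z)|\le\ell_J|z'-z|$ for all $\alpha\in A$, $z,z'\in\mathbb{R}$; (iv) $|b(\alpha,z)|\le c_0$ for all $\alpha\in A$, $z\in\mathbb{R}$. Let $(W^N)_{N\ge1}$ be a sequence of symmetric matrices $W^N\in\mathbb{R}^{N\times N}$ satisfying, for some constant $\tilde\zeta$, $\max_{i=1,\dots,N}\frac1{N^2}\sum_{j=1}^N(W^N_{i,j})^2\le\tilde\zeta$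 for all $N$. Let $w^N=\Psi^N(W^N)$, with graphon operator $\mathbf{W}^N$, and suppose there exist a graphon $w$ with graphon operator $\mathbf{W}$ and a constant $\zeta$ such that $\sqrt{2c_z}\,\|w\|_2<1$, $\sqrt{c_z}\,\|\mathbf{W}\|<1$, $\sup_{x\in I}\bigl(\int_I w(x,y)^2dy\bigr)^{1/2}\le\zeta$, $\lim_{N\to\infty}\|w^N\|_2=\|w\|_2$, $\lim_{N\to\infty}\|\mathbf{W}^N\|=\|\mathbf{W}\|$, and $d_\square(w^N,w)\le\gamma_N$ where $N\gamma_N\to0$ as $N\to\infty$. Let $\hat{\boldsymbol{\alpha}}$ be a Nash equilibrium for the graphon game with graphon $w$. Then there is a sequence $\epsilon_N\ge0$ with $\epsilon_N\to0$ as $N\to\infty$ such that, for all sufficiently large $N$, the strategy profile $\mu^N(\hat{\boldsymbol{\alpha}})\in A^N$ is an $\epsilon_N$-Nash equilibrium for the $N$-player game with interaction matrix $W^N$.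
   Context: Data. $I=[0,1]$ with Lebesgue measure; $L^2(I)$ is the usual real Lebesgue space. $A\subset\mathbb{R}$ is a nonempty closed convex set of actions, $\mathbb{A}=\{\boldsymbol{\alpha}\in L^2(I):\boldsymbol{\alpha}\text{ takes values in }A\}$. $\mu_0$ is a mean-zero probability measure on $\mathbb{R}$, $\xi_0\sim\mu_0$; $b:A\times\mathbb{R}\to\mathbb{R}$, $f:\mathbb{R}\times A\times\mathbb{R}\to\mathbb{R}$. $\mathcal{K}$ is the set of probability measures on $\mathbb{R}\times\mathbb{R}$ with first marginal $\mu_0$; for $\alpha\in A,\nu\in\mathcal{K}$, $\tilde{\mathcal{J}}(\alpha,\nu)=\int f(b(\alpha,z)+\xi,\alpha,z)\,\nu(d\xi,dz)$ (assumed well defined), and $\mathcal{J}(\alpha,z)=\tilde{\mathcal{J}}(\alpha,\mu_0\otimes\delta_z)=\mathbb{E}[f(b(\alpha,z)+\xi_0,\alpha,z)]$. $W_2$ is the 2-Wasserstein distance. $N$-player game with symmetric interaction matrix $W\in\mathbb{R}^{N\times N}$: $\xi_1,\dots,\xi_N$ are i.i.d. with law $\mu_0$ on a probability space $\Omega$. For $\boldsymbol{\alpha}\in A^N$, $\mathbf{Z}_N\boldsymbol{\alpha}=\mathbf{z}\in L^2(\Omega;\mathbb{R}^N)$ is the unique solution of $z_i=\frac1N\sum_{j=1}^N W_{i,j}[b(\alpha_j,z_j)+\xi_j]$, $i=1,\dots,N$, which exists and is unique when $c_z\frac1{N^2}\sum_{i,j}W_{i,j}^2<1$ (true for $W=W^N$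 and all large $N$ under the hypotheses). For $\epsilon\ge0$, $\boldsymbol{\alpha}^N\in A^N$ is an $\epsilon$-Nash equilibrium if for all $i=1,\dots,N$ and $\beta\in A$, $$\tilde{\mathcal{J}}(\alpha^N_i,\mathcal{L}(\xi_i,[\mathbf{Z}_N\boldsymbol{\alpha}^N]_i))\le\tilde{\mathcal{J}}(\beta,\mathcal{L}(\xi_i,[\mathbf{Z}_N[\beta;\boldsymbol{\alpha}^N_{-i}]]_i))+\epsilon,$$ where $\mathcal{L}$ denotes the joint law and $[\beta;\boldsymbol{\alpha}^N_{-i}]$ is $\boldsymbol{\alpha}^N$ with $i$-th entry replaced by $\beta$. Graphon game: a graphon is a symmetric Borel measurable square-integrable $w:I\times I\to\mathbb{R}$, with norm $\|w\|_2$ in $L^2(I\times I)$ and operator $[\mathbf{W}g]_x=\int_I w(x,y)g(y)\,dy$ on $L^2(I)$ with operator norm $\|\mathbf{W}\|$. If $\sqrt{c_z}\|\mathbf{W}\|<1$, for $\boldsymbol{\alpha}\in\mathbb{A}$ let $\mathbf{Z}\boldsymbol{\alpha}$ be the unique $\mathbf{z}\in L^2(I)$ with $z_x=\int_I w(x,y)b(\alpha_y,z_y)\,dy$ for a.e. $x$. A Nash equilibrium is $\hat{\boldsymbol{\alpha}}\in\mathbb{A}$ such that for a.e. $x$, $\mathcal{J}(\hat\alpha_x,[\mathbf{Z}\hat{\boldsymbol{\alpha}}]_x)\le\mathcal{J}(\beta,[\mathbf{Z}\hat{\boldsymbol{\alpha}}]_x)$ for all $\beta\in A$. Notation: $\Psi^N(W)(x,y)=W_{i,j}$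 for $x\in[(i-1)/N,i/N)$, $y\in[(j-1)/N,j/N)$; $[\mu^N(\mathbf{z})]_i=N\int_{(i-1)/N}^{i/N}z_x\,dx$ for $\mathbf{z}\in L^2(I)$; $d_\square(w,w')=\|w-w'\|_\square$ with $\|w\|_\square=\sup_{S,T\in\mathcal{B}(I)}|\int_{S\times T}w\,dxdy|$. *)

(* Defs.v *)
From HB Require Import structures.
From mathcomp Require Import all_boot all_order all_algebra.
From mathcomp Require Import all_classical all_reals all_analysis.

Set Implicit Arguments.
Unset Strict Implicit.
Unset Printing Implicit Defensive.

Import Order.TTheory GRing.Theory Num.Theory.
Import numFieldNormedType.Exports.

Local Open Scope classical_set_scope.
Local Open Scope ring_scope.

Section JointLaw.
Context d (Omega : measurableType d) (R : realType).

Definition joint (X Y : {mfun Omega >-> R}) (omega : Omega) : R * R :=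
  (X omega, Y omega).

Lemma measurable_joint (X Y : {mfun Omega >-> R}) :
  measurable_fun setT (joint X Y).
Proof. exact: measurable_fun_pair. Qed.

HB.instance Definition _ (X Y : {mfun Omega >-> R}) :=
  isMeasurableFun.Build _ _ _ _ (joint X Y) (measurable_joint X Y).

Definition joint_law (P : probability Omega R) (X Y : {mfun Omega >-> R}) :
  probability (R * R)%type R := distribution P (joint X Y).

Definition mutually_independent (P : probability Omega R) (I : finType)
    (X : I -> {mfun Omega >-> R}) : Prop :=
  forall (J : {set I}) (B : I -> set R), (forall i, measurable (B i)) ->
  P (\bigcap_(i in [set` J]) (X i @^-1` B i))
    = (\prod_(i in J) P (X i @^-1` B i))%E.

Definition iid (P : probability Omega R) (mu0 : probability R R) (I : finType)
    (X : I -> {mfun Omega >-> R}) : Prop :=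
  (forall i (B : set R), measurable B -> distribution P (X i) B = mu0 B) /\
  mutually_independent P X.

End JointLaw.

Section Wasserstein.
Context (R : realType).

Definition sqdist (p q : R * R) : R := (p.1 - q.1) ^+ 2 + (p.2 - q.2) ^+ 2.

Definition coupling (nu nu' : probability (R * R)%type R)
    (pi : probability ((R * R) * (R * R))%type R) : Prop :=
  forall B : set (R * R), measurable B ->
    pi (fst @^-1` B) = nu B /\ pi (snd @^-1` B) = nu' B.

Definition W2 (nu nu' : probability (R * R)%type R) : \bar R :=
  (ereal_inf [set (\int[pi]_p (sqdist p.1 p.2)%:E)%E | pi in coupling nu nu']
     `^ 2^-1)%E.

End Wasserstein.

Section Cost.
Context (R : realType).
Variables (b : R -> R -> R) (f : R -> R -> R -> R) (mu0 : probability R R).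

Definition calK : set (probability (R * R)%type R) :=
  [set nu | forall B : set R, measurable B -> nu (fst @^-1` B) = mu0 B].

(* A point of R * R is (xi, z). *)
Definition cost_integrand (alpha : R) (p : R * R) : R :=
  f (b alpha p.2 + p.1) alpha p.2.

Definition Jt (alpha : R) (nu : probability (R * R)%type R) : R :=
  \int[nu]_p cost_integrand alpha p.

Definition Jc (alpha z : R) : R := Jt alpha (mu0 \x \d_z)%E.

End Cost.

Section NPlayer.
Context (R : realType) d (Omega : measurableType d) (P : probability Omega R).
Variables (A : set R) (b : R -> R -> R) (f : R -> R -> R -> R).
Variables (N : nat) (W : 'M[R]_N) (xi : 'I_N -> {mfun Omega >-> R}).

Definition solves_state (alpha : 'I_N -> R) (z : 'I_N -> {mfun Omega >-> R}) :=
  (forall i, (z i : Omega -> R) \in Lfun P 2%:E) /\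
  (forall i, \forall omega \ae P,
     z i omega = N%:R^-1 *
       \sum_(j < N) W i j * (b (alpha j) (z j omega) + xi j omega)).

(* [z] is the state Z_N alpha: the unique solution in L^2(Omega; R^N), where
   elements of L^2 are identified almost surely. *)
Definition is_state (alpha : 'I_N -> R) (z : 'I_N -> {mfun Omega >-> R}) :=
  solves_state alpha z /\
  forall z', solves_state alpha z' ->
    forall i, \forall omega \ae P, z' i omega = z i omega.

Definition replace (alpha : 'I_N -> R) (i : 'I_N) (beta : R) (j : 'I_N) : R :=
  if j == i then beta else alpha j.

(* Z_N is a partial map, so the equilibrium condition includes that it is
   defined at the profiles it compares. *)
Definition eps_nash (eps : R) (alpha : 'I_N -> R) : Prop :=
  (forall i, A (alpha i)) /\
  forall (i : 'I_N) (beta : R), A beta ->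
  exists z z' : 'I_N -> {mfun Omega >-> R},
    [/\ is_state alpha z, is_state (replace alpha i beta) z' &
      Jt b f (alpha i) (joint_law P (xi i) (z i)) <=
      Jt b f beta (joint_law P (xi i) (z' i)) + eps].

End NPlayer.

Section Graphon.
Context (R : realType).

Notation mu := (@lebesgue_measure R).
Notation mu2 := ((@lebesgue_measure R) \x (@lebesgue_measure R))%E.

Definition I01 : set R := `[0, 1]%classic.

(* A function on I (or I x I) is represented by a function on R (or R x R) of
   which only the restriction matters; [g \_ D] is its extension by 0. *)
Definition L2I (g : R -> R) : Prop := g \_ I01 \in Lfun mu 2%:E.

Definition normL2I (g : R -> R) : \bar R :=
  ('N[mu]_(2%:E)[EFin \o (g \_ I01)])%E.

Definition graphon (w : R * R -> R) : Prop :=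
  (forall x y, I01 x -> I01 y -> w (x, y) = w (y, x)) /\
  w \_ (I01 `*` I01) \in Lfun mu2 2%:E.

Definition normL2II (w : R * R -> R) : \bar R :=
  ('N[mu2]_(2%:E)[EFin \o (w \_ (I01 `*` I01))])%E.

Definition graphon_op (w : R * R -> R) (g : R -> R) (x : R) : R :=
  \int[mu]_(y in I01) (w (x, y) * g y).

Definition opnorm (w : R * R -> R) : \bar R :=
  ereal_sup [set normL2I (graphon_op w g)
            | g in [set g | L2I g /\ (normL2I g <= 1)%E]].

Definition cutnorm (w : R * R -> R) : \bar R :=
  ereal_sup [set c | exists S T : set R,
    [/\ measurable S, measurable T, S `<=` I01, T `<=` I01 &
      c = `| \int[mu2]_(p in S `*` T) (w p)%:E |%E]].

Definition cell (N i : nat) : set R :=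
  [set x | i%:R / N%:R <= x < i.+1%:R / N%:R].

(* Indices start from 0; the value on the lines x = 1 and y = 1 is 0. *)
Definition Psi (N : nat) (W : 'M[R]_N) (p : R * R) : R :=
  \sum_(i < N) \sum_(j < N) W i j * \1_(cell N i) p.1 * \1_(cell N j) p.2.

Definition muN (N : nat) (g : R -> R) (i : 'I_N) : R :=
  N%:R * \int[mu]_(x in `[i%:R / N%:R, i.+1%:R / N%:R]) g x.

Variables (A : set R) (b : R -> R -> R).

Definition calA : set (R -> R) :=
  [set alpha | L2I alpha /\ \forall x \ae mu, I01 x -> A (alpha x)].

Definition solves_graphon_state (w : R * R -> R) (alpha z : R -> R) : Prop :=
  L2I z /\ \forall x \ae mu, I01 x ->
    z x = \int[mu]_(y in I01) (w (x, y) * b (alpha y) (z y)).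

(* [z] is the state Z alpha: the unique solution in L^2(I). *)
Definition is_graphon_state (w : R * R -> R) (alpha z : R -> R) : Prop :=
  solves_graphon_state w alpha z /\
  forall z', solves_graphon_state w alpha z' ->
    \forall x \ae mu, I01 x -> z' x = z x.

Definition graphon_nash (f : R -> R -> R -> R) (mu0 : probability R R)
    (w : R * R -> R) (alpha : R -> R) : Prop :=
  calA alpha /\
  exists z, is_graphon_state w alpha z /\
    \forall x \ae mu, I01 x -> forall beta, A beta ->
      Jc b f mu0 (alpha x) (z x) <= Jc b f mu0 beta (z x).

End Graphon.

(* The derivative is taken within [A], hence one-sided at the endpoints of an
   interval [A]; the first condition is void when [A] is a singleton. *)
Definition C1_on (R : realType) (A : set R) (g g' : R -> R) : Prop :=
  (forall a, A a ->
     (fun x => (g x - g a) / (x - a)) @ within A a^' --> g' a) /\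
  {within A, continuous g'}.

(* Main.v *)
Require Import Defs.
From HB Require Import structures.
From mathcomp Require Import all_boot all_order all_algebra.
From mathcomp Require Import all_classical all_reals all_analysis.
From mathcomp Require Import measurable_realfun.
From mathcomp Require Import ring lra.

Set Implicit Arguments.
Unset Strict Implicit.
Unset Printing Implicit Defensive.

Import Order.TTheory GRing.Theory Num.Theory.
Import numFieldNormedType.Exports.

Local Open Scope classical_set_scope.
Local Open Scope ring_scope.

(** The averaged graphon equilibrium is approximately optimal for every single
    player, uniformly, because a cut distance of order [o(1/N)] is an estimate
    on each cell of length [1/N] separately.

    The cut norm bounds the operator norm from L^oo to L^1 up to a factor 4
    ([cutnorm_op_bound]).  On the cell of player [i] the image of a function
    under the step graphon is a constant, so averaging over that cell gives, for
    bounded [phi], that [i]-th constant is within [4 c N gamma_N] on average of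
    the image of [phi] under the graphon ([avg_op_close]).  This is used twice.
    - With [phi] the integrand [b(alphahat, z)] of the graphon state: the
      constant [v i] so obtained is close, on average over the cell, to the state
      [z x].  For [x] in the cell, [alphahat x] is optimal at [z x], hence
      nearly optimal at [v i], since the cost is Lipschitz in the state.
      Averaging keeps near-optimality by convexity ([avg_action_opt]), and strong
      convexity makes all these nearly optimal actions close to each other
      ([avg_action_near]); therefore [v] almost solves the state equation of the
      finite game without noise.
    - With [phi] a combination of signs on cells: the mass that row [i] of the
      matrix, divided by [N], gives to a set of [k] players is at most
      [4 N gamma_N + zeta sqrt (k / N)] ([row_mass]).  So row masses are bounded,
      single entries are negligible (a deviating player hardly influences the
      states), the noise averages out for each player, and rows are uniformly
      integrable.

    For a profile which differs from the averaged one in one player only, the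
    difference between the state of the finite game and [v] is controlled in
    mean square: the contraction condition gives smallness on average over the
    players, and uniform integrability of the rows upgrades this to each player
    ([deviation_bound]).  Finally, using the same noise on both sides as a
    coupling, the Wasserstein-Lipschitz property of the cost replaces the random
    state of player [i] by the constant [v i], both for the averaged profile and
    for its deviation ([Jt_joint_law_close]), and near-optimality at [v i]
    concludes. *)

(** * Integration complements *)

Section Integration.
Context d (T : measurableType d) (R : realType).
Variable mu : {measure set T -> \bar R}.
Implicit Types (D : set T) (f g : T -> R).

Import HBNNSimple.

Lemma aeS (p q : T -> Prop) : (\forall x \ae mu, p x) ->
  (forall x, p x -> q x) -> \forall x \ae mu, q x.
Proof. by move=> hp pq; exact: filterS hp. Qed.

Lemma aeS2 (p q r : T -> Prop) : (\forall x \ae mu, p x) ->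
  (\forall x \ae mu, q x) -> (forall x, p x -> q x -> r x) ->
  \forall x \ae mu, r x.
Proof. by move=> hp hq pqr; exact: filterS2 hp hq. Qed.

Lemma ge0_le_integral_off_null (N : set T) (f g : T -> \bar R) :
  measurable N -> mu N = 0%E ->
  (forall x, 0 <= f x)%E -> (forall x, 0 <= g x)%E ->
  (forall x, ~ N x -> f x = g x) ->
  (\int[mu]_x f x <= \int[mu]_x g x)%E.
Proof.
move=> mN N0 f0 g0 fg; rewrite (ge0_integralTE _ f0) (ge0_integralTE _ g0).
apply: ge_ereal_sup => _ [h /= hf <-].
have mC : measurable (~` N) by exact: measurableC.
have -> : sintegral mu h = sintegral mu (proj_nnsfun h mC).
  rewrite -!integralT_nnsfun (ge0_negligible_integral mN)//; last first.
  - by move=> x _; rewrite lee_fin fun_ge0.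
  - exact/measurable_EFinP.
  rewrite [RHS](ge0_negligible_integral mN)//; last first.
  - by move=> x _; rewrite lee_fin fun_ge0.
  - exact/measurable_EFinP.
  apply: eq_integral => x /set_mem[_ Nx] /=.
  by rewrite mindicE mem_set// mulr1.
apply: ereal_sup_ubound => /=; exists (proj_nnsfun h mC) => //= x.
rewrite mindicE; have [/set_mem Nx|_] := boolP (x \in ~` N).
  by rewrite mulr1 -fg.
by rewrite mulr0.
Qed.

(** The integral is a supremum over simple functions, and multiplying a simple
    function by the indicator of a conull measurable set does not change its
    integral.  The lemma is meant for integrands containing [b], which is
    arbitrary outside the action set, so that they only agree almost everywhere
    with a measurable function. *)
Lemma ae_eq_integral_nonmeasurable D (f g : T -> \bar R) :
  (\forall x \ae mu, D x -> f x = g x) ->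
  (\int[mu]_(x in D) f x = \int[mu]_(x in D) g x)%E.
Proof.
move=> [N [mN N0 fgN]].
rewrite integral_mkcond [RHS]integral_mkcond.
rewrite integralE [RHS]integralE.
have fg x : ~ N x -> (f \_ D) x = (g \_ D) x.
  move=> Nx; rewrite !patchE; case: ifPn => // /set_mem Dx.
  by apply: contrapT => fgx; apply: Nx; apply: fgN => /= /(_ Dx).
have fgp x : ~ N x -> (f \_ D)^\+%E x = (g \_ D)^\+%E x.
  by move=> Nx; rewrite !funeposE fg.
have fgn x : ~ N x -> (f \_ D)^\-%E x = (g \_ D)^\-%E x.
  by move=> Nx; rewrite !funenegE fg.
by congr (_ - _)%E; apply/eqP; rewrite eq_le; apply/andP; split;
  apply: (ge0_le_integral_off_null mN N0) => // x Nx; rewrite ?fgp ?fgn.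
Qed.

Lemma ae_eq_Rintegral D f g : (\forall x \ae mu, D x -> f x = g x) ->
  \int[mu]_(x in D) f x = \int[mu]_(x in D) g x.
Proof.
move=> fg; congr fine; apply: ae_eq_integral_nonmeasurable.
by apply: filterS fg => x /[apply] ->.
Qed.

Lemma ae_le_Rintegral D f g : measurable D ->
  mu.-integrable D (EFin \o f) -> mu.-integrable D (EFin \o g) ->
  (\forall x \ae mu, D x -> f x <= g x) ->
  \int[mu]_(x in D) f x <= \int[mu]_(x in D) g x.
Proof.
move=> mD fi gi fg.
have mf : measurable_fun D f by apply/measurable_EFinP/(measurable_int mu).
have mg : measurable_fun D g by apply/measurable_EFinP/(measurable_int mu).
have mi : mu.-integrable D (EFin \o (fun x => Num.min (f x) (g x))).
  have := integrableD mD (integrable_abse fi) (integrable_abse gi).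
  apply: le_integrable => //.
    by apply/measurable_EFinP; exact: measurable_minr.
  move=> x _ /=; rewrite lee_fin [leRHS]ger0_norm ?addr_ge0//.
  by case: (leP (f x) (g x)) => _; rewrite ?lerDl ?lerDr.
rewrite (_ : \int[mu]_(x in D) f x = \int[mu]_(x in D) Num.min (f x) (g x)).
  by apply: le_Rintegral => // x _; rewrite ge_min lexx orbT.
apply: ae_eq_Rintegral; apply: filterS fg => x h Dx.
by rewrite min_l// h.
Qed.

Lemma integrable_le D f g : measurable D -> measurable_fun D f ->
  mu.-integrable D (EFin \o g) ->
  (forall x, D x -> `|f x| <= g x) -> mu.-integrable D (EFin \o f).
Proof.
move=> mD mf gi fg; apply: le_integrable gi => //; first exact/measurable_EFinP.
by move=> x Dx /=; rewrite lee_fin (le_trans (fg _ Dx)) ?ler_norm.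
Qed.

Lemma integrable_addr D f g : measurable D ->
  mu.-integrable D (EFin \o f) -> mu.-integrable D (EFin \o g) ->
  mu.-integrable D (EFin \o (fun x => f x + g x)).
Proof. by move=> mD fi gi; apply: eq_integrable (integrableD mD fi gi). Qed.

Lemma integrable_subr D f g : measurable D ->
  mu.-integrable D (EFin \o f) -> mu.-integrable D (EFin \o g) ->
  mu.-integrable D (EFin \o (fun x => f x - g x)).
Proof. by move=> mD fi gi; apply: eq_integrable (integrableB mD fi gi). Qed.

Lemma integrable_mulrl D f (k : R) : measurable D ->
  mu.-integrable D (EFin \o f) -> mu.-integrable D (EFin \o (fun x => k * f x)).
Proof. by move=> mD fi; apply: eq_integrable (integrableZl mD k fi). Qed.

Lemma integrable_normr D f : measurable D ->
  mu.-integrable D (EFin \o f) -> mu.-integrable D (EFin \o (fun x => `|f x|)).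
Proof. by move=> mD fi; apply: eq_integrable (integrable_abse fi). Qed.

Lemma integrable_sumr D (I : Type) (s : seq I) (P : pred I) (F : I -> T -> R) :
  measurable D -> (forall i, P i -> mu.-integrable D (EFin \o F i)) ->
  mu.-integrable D (EFin \o (fun x => \sum_(i <- s | P i) F i x)).
Proof.
move=> mD Fi; apply: eq_integrable (integrable_sum mD s Fi) => // x _ /=.
by rewrite sumEFin.
Qed.

Lemma Rintegral_sum D (I : Type) (s : seq I) (P : pred I) (F : I -> T -> R) :
  measurable D -> (forall i, P i -> mu.-integrable D (EFin \o F i)) ->
  \int[mu]_(x in D) (\sum_(i <- s | P i) F i x) =
  \sum_(i <- s | P i) \int[mu]_(x in D) F i x.
Proof.
move=> mD Fi; elim: s => [|i s IH].
  rewrite big_nil; under eq_Rintegral do rewrite big_nil.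
  by rewrite Rintegral_cst// mul0r.
under eq_Rintegral do rewrite big_cons; rewrite big_cons.
case: ifPn => Pi //; rewrite -IH RintegralD//; first exact: Fi.
exact: integrable_sumr.
Qed.

Lemma integrable_mul_bounded D f g (c : R) : measurable D ->
  mu.-integrable D (EFin \o f) -> measurable_fun D g ->
  (forall x, D x -> `|g x| <= c) ->
  mu.-integrable D (EFin \o (fun x => f x * g x)).
Proof.
move=> mD fi mg gc.
have mf : measurable_fun D f by apply/measurable_EFinP/(measurable_int mu).
apply: (@integrable_le _ _ (fun x => c * `|f x|)) => //.
- exact: measurable_funM.
- exact/integrable_mulrl/integrable_normr.
- by move=> x Dx; rewrite normrM mulrC ler_wpM2r// gc.
Qed.

Lemma integrable_of_sqr D f : measurable D -> (mu D < +oo)%E ->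
  measurable_fun D f -> mu.-integrable D (EFin \o (fun x => f x ^+ 2)) ->
  mu.-integrable D (EFin \o f).
Proof.
move=> mD Dfin mf f2; apply: (@integrable_le _ _ (fun x => 1 + f x ^+ 2)) => //.
  apply: integrable_addr => //.
  have -> : EFin \o (fun=> 1 : R) = EFin \o cst (1 : R) :> (T -> \bar R) by [].
  apply: measurable_bounded_integrable => //.
  exact: bounded_cst.
move=> x _; rewrite -[f x ^+ 2]real_normK ?num_real//; nra.
Qed.

Lemma integrable_restrictP D f : measurable D ->
  mu.-integrable setT (EFin \o (f \_ D)) <-> mu.-integrable D (EFin \o f).
Proof. by move=> mD; rewrite -restrict_EFin; split => /(integrable_mkcond _ mD). Qed.

Lemma L2normE f : measurable_fun setT f ->
  mu.-integrable setT (EFin \o (fun x => f x ^+ 2)) ->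
  ('N[mu]_(2%:E)[EFin \o f])%E = (Num.sqrt (\int[mu]_x (f x ^+ 2)))%:E.
Proof.
move=> mf f2; rewrite unlock.
have e x : (`|(f x)%:E| `^ 2)%E = (f x ^+ 2)%:E.
  by rewrite /= powR_mulrn// real_normK ?num_real.
under eq_integral do rewrite e.
rewrite /Rintegral -[in LHS](fineK (integrable_fin_num measurableT f2)).
rewrite poweR_EFin powR12_sqrt// fine_ge0//.
by apply: integral_ge0 => x _; rewrite lee_fin sqr_ge0.
Qed.

Lemma Lfun2P f : f \in Lfun mu 2%:E <->
  measurable_fun setT f /\ mu.-integrable setT (EFin \o (fun x => f x ^+ 2)).
Proof.
split=> [fL|[mf f2]].
  split; last exact: Lfun2_integrable_sqr.
  by move: fL; rewrite inE => /andP[/set_mem].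
rewrite inE; apply/andP; split; first by rewrite inE.
by rewrite inE /= /finite_norm L2normE// ltry.
Qed.

End Integration.

(** * Fubini for real-valued integrands, and the cut norm *)

Section RealFubini.
Context d1 d2 (T1 : measurableType d1) (T2 : measurableType d2) (R : realType).
Variables (m1 : {sigma_finite_measure set T1 -> \bar R})
          (m2 : {sigma_finite_measure set T2 -> \bar R}).
Variable f : T1 * T2 -> R.
Hypothesis fi : (m1 \x m2)%E.-integrable setT (EFin \o f).

Let mf : measurable_fun setT (EFin \o f). Proof. exact: measurable_int fi. Qed.

Let fine_le (x : \bar R) : (`|(fine x)%:E| <= `|x|)%E.
Proof. by case: x => [r| |] //=; rewrite normr0 ?leey. Qed.

Lemma integrable_Rfubini1 :
  m1.-integrable setT (EFin \o (fun x => \int[m2]_y f (x, y))).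
Proof.
pose g x := (\int[m2]_y `|(EFin \o f) (x, y)|)%E.
have mg : measurable_fun setT g.
  by apply: (measurable_fun_fubini_tonelli_F (abse \o (EFin \o f))) => //=;
    exact: measurableT_comp.
have g0 x : (0 <= g x)%E by exact: integral_ge0.
have gi : m1.-integrable setT g.
  apply/integrableP; split=> //; under eq_integral do rewrite gee0_abs//.
  exact/(integrable12ltyP _ _ mf).1.
apply: le_integrable gi => //.
  by apply/measurableT_comp => //; apply: measurableT_comp => //;
    exact: measurable_fubini_F fi.
move=> x _ /=; apply: (le_trans (fine_le _)); rewrite [leRHS]gee0_abs//.
apply: (le_abse_integral _ measurableT); exact: (measurable_fun_pair2 x mf).
Qed.

Lemma integrable_Rfubini2 :
  m2.-integrable setT (EFin \o (fun y => \int[m1]_x f (x, y))).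
Proof.
pose g y := (\int[m1]_x `|(EFin \o f) (x, y)|)%E.
have mg : measurable_fun setT g.
  by apply: (measurable_fun_fubini_tonelli_G (abse \o (EFin \o f))) => //=;
    exact: measurableT_comp.
have g0 y : (0 <= g y)%E by exact: integral_ge0.
have gi : m2.-integrable setT g.
  apply/integrableP; split=> //; under eq_integral do rewrite gee0_abs//.
  exact/(integrable21ltyP _ _ mf).1.
apply: le_integrable gi => //.
  by apply/measurableT_comp => //; apply: measurableT_comp => //;
    exact: measurable_fubini_G fi.
move=> y _ /=; apply: (le_trans (fine_le _)); rewrite [leRHS]gee0_abs//.
apply: (le_abse_integral _ measurableT); exact: (measurable_fun_pair1 y mf).
Qed.

Lemma Rfubini1 :
  \int[m1]_x (\int[m2]_y f (x, y)) = \int[(m1 \x m2)%E]_z f z.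
Proof.
rewrite [RHS]/Rintegral -[X in _ = fine X](integral12_prod_meas1 fi).
congr fine; apply: ae_eq_integral_nonmeasurable.
apply: filterS (ae_integrable1 fi) => x xi _.
by rewrite fineK//; exact: integrable_fin_num.
Qed.

Lemma Rfubini2 :
  \int[m2]_y (\int[m1]_x f (x, y)) = \int[(m1 \x m2)%E]_z f z.
Proof.
rewrite [RHS]/Rintegral -[X in _ = fine X](integral21_prod_meas1 fi).
congr fine; apply: ae_eq_integral_nonmeasurable.
apply: filterS (ae_integrable2 fi) => x xi _.
by rewrite fineK//; exact: integrable_fin_num.
Qed.

End RealFubini.

Section SignedIntegral.
Context d (T : measurableType d) (R : realType).
Variable mu : {measure set T -> \bar R}.

Lemma Rintegral_indic_mulr (A : set T) (f : T -> R) :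
  \int[mu]_x (f x * \1_A x) = \int[mu]_(x in A) f x.
Proof.
rewrite [RHS]Rintegral_mkcond; apply: eq_Rintegral => x _.
by rewrite patchE indicE; case: (_ \in _); rewrite ?mulr1 ?mulr0.
Qed.

Lemma norm_indic_le1 (A : set T) (x : T) : `|\1_A x : R| <= 1.
Proof. by rewrite indicE; case: (_ \in _); rewrite ?normr1 ?normr0. Qed.

(** Integrating over the positive and the negative part separately. *)
Lemma Rintegral_norm_le2 (G : T -> R) (c : R) :
  mu.-integrable setT (EFin \o G) ->
  (forall A, measurable A -> `|\int[mu]_(x in A) G x| <= c) ->
  \int[mu]_x `|G x| <= 2 * c.
Proof.
move=> Gi Gc.
have mG : measurable_fun setT G by apply/measurable_EFinP/(measurable_int mu).
pose A := [set x | 0 <= G x].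
have mA : measurable A.
  have -> : A = setT `&` G @^-1` `[0, +oo[%classic.
    by rewrite setTI; apply/seteqP; split => x /=; rewrite in_itv /= andbT.
  exact: mG.
have mC : measurable (~` A) by exact: measurableC.
have iA B : measurable B -> mu.-integrable setT (EFin \o (fun x => G x * \1_B x)).
  move=> mB; apply: (integrable_mul_bounded (c := 1)) => //.
  by move=> x _; exact: norm_indic_le1.
have -> : \int[mu]_x `|G x| =
    \int[mu]_x (G x * \1_A x - G x * \1_(~` A) x).
  apply: eq_Rintegral => x _; rewrite !indicE in_setC.
  have [/set_mem Ax|/negP Ax] := boolP (x \in A); rewrite /= ?mulr1 ?mulr0.
    by rewrite subr0 ger0_norm.
  rewrite sub0r ltr0_norm// ltNge; apply/negP => h; apply: Ax.
  by rewrite inE.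
rewrite RintegralB//; [|exact: iA|exact: iA].
rewrite !Rintegral_indic_mulr.
have := Gc _ mA; have := Gc _ mC.
rewrite !ler_norml => /andP[? ?] /andP[? ?]; lra.
Qed.

End SignedIntegral.

Section CutNorm.
Context d1 d2 (T1 : measurableType d1) (T2 : measurableType d2) (R : realType).
Variables (m1 : {sigma_finite_measure set T1 -> \bar R})
          (m2 : {sigma_finite_measure set T2 -> \bar R}).
Variables (k : T1 * T2 -> R) (phi : T2 -> R) (c g : R).
Hypothesis ki : (m1 \x m2)%E.-integrable setT (EFin \o k).
Hypothesis kcut : forall S U, measurable S -> measurable U ->
  `|\int[(m1 \x m2)%E]_z (k z * \1_S z.1 * \1_U z.2)| <= g.
Hypothesis mphi : measurable_fun setT phi.
Hypothesis c0 : 0 <= c.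
Hypothesis phic : forall y, `|phi y| <= c.

Let mphi2 : measurable_fun setT (fun z : T1 * T2 => phi z.2).
Proof. exact: measurableT_comp. Qed.

Let kphii : (m1 \x m2)%E.-integrable setT (EFin \o (fun z => k z * phi z.2)).
Proof. by apply: (integrable_mul_bounded (c := c)) => // z _. Qed.

Let mind1 S : measurable S ->
  measurable_fun setT (fun z : T1 * T2 => \1_S z.1 : R).
Proof. by move=> mS; apply: measurableT_comp => //; exact: measurable_indic. Qed.

Let mind2 S : measurable S ->
  measurable_fun setT (fun z : T1 * T2 => \1_S z.2 : R).
Proof. by move=> mS; apply: measurableT_comp => //; exact: measurable_indic. Qed.

Let kS S : measurable S ->
  (m1 \x m2)%E.-integrable setT (EFin \o (fun z => k z * \1_S z.1)).
Proof.
move=> mS; apply: (integrable_mul_bounded (c := 1)) => //; first exact: mind1.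
by move=> z _; exact: norm_indic_le1.
Qed.

Lemma integrable_cut_apply :
  m1.-integrable setT (EFin \o (fun x => \int[m2]_y (k (x, y) * phi y))).
Proof. exact: (integrable_Rfubini1 kphii). Qed.

(** The cut norm controls the operator norm from L^oo to L^1: for fixed [S]
    the function [y |-> \int_S k(x, y) dx] has all its set integrals bounded by
    the cut norm, hence L^1 norm at most twice that; pairing it with [phi] bounds
    all set integrals of the image of [phi]. *)
Lemma cutnorm_op_bound :
  \int[m1]_x `|\int[m2]_y (k (x, y) * phi y)| <= 4 * c * g.
Proof.
rewrite (_ : 4 * c * g = 2 * (c * (2 * g))); last by ring.
apply: Rintegral_norm_le2; first exact: integrable_cut_apply.
move=> S mS; rewrite -Rintegral_indic_mulr.
pose GS y := \int[m1]_x (k (x, y) * \1_S x).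
have GSi : m2.-integrable setT (EFin \o GS) by exact: (integrable_Rfubini2 (kS mS)).
have GS1 : \int[m2]_y `|GS y| <= 2 * g.
  apply: Rintegral_norm_le2 => // U mU; rewrite -Rintegral_indic_mulr.
  have kSU : (m1 \x m2)%E.-integrable setT
      (EFin \o (fun z => k z * \1_S z.1 * \1_U z.2)).
    apply: (integrable_mul_bounded (c := 1)) => //; [exact: kS|exact: mind2|].
    by move=> z _; exact: norm_indic_le1.
  have := kcut mS mU; rewrite -(Rfubini2 kSU) /=; congr (`|_| <= _).
  apply: ae_eq_Rintegral; apply: filterS (ae_integrable2 (kS mS)) => y yi _.
  by rewrite RintegralZr.
have kSphi : (m1 \x m2)%E.-integrable setT
    (EFin \o (fun z => k z * \1_S z.1 * phi z.2)).
  by apply: (integrable_mul_bounded (c := c)) => //; exact: kS.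
have -> : \int[m1]_x (\int[m2]_y (k (x, y) * phi y) * \1_S x) =
          \int[m2]_y (GS y * phi y).
  transitivity (\int[(m1 \x m2)%E]_z (k z * \1_S z.1 * phi z.2)).
    rewrite -(Rfubini1 kSphi) /=; apply: ae_eq_Rintegral.
    apply: filterS (ae_integrable1 kphii) => x xi _.
    rewrite -RintegralZr//; apply: eq_Rintegral => y _; ring.
  rewrite -(Rfubini2 kSphi) /=; apply: ae_eq_Rintegral.
  apply: filterS (ae_integrable2 (kS mS)) => y yi _.
  by rewrite RintegralZr.
have GSphi : m2.-integrable setT (EFin \o (fun y => GS y * phi y)).
  by apply: (integrable_mul_bounded (c := c)).
apply: (le_trans (le_normr_Rintegral measurableT GSphi)).
apply: (@le_trans _ _ (\int[m2]_y (c * `|GS y|))).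
  apply: le_Rintegral => //.
  - exact: integrable_normr.
  - by apply: integrable_mulrl => //; exact: integrable_normr.
  - by move=> y _; rewrite normrM mulrC ler_wpM2r.
rewrite RintegralZl//; last exact: integrable_normr.
exact: ler_wpM2l.
Qed.

End CutNorm.

(** * Cells and step graphons *)

Section CauchySchwarz.
Context d (T : measurableType d) (R : realType).
Variable mu : {measure set T -> \bar R}.
Variables f g : T -> R.
Hypothesis mf : measurable_fun setT f.
Hypothesis mg : measurable_fun setT g.
Hypothesis f2 : mu.-integrable setT (EFin \o (fun x => f x ^+ 2)).
Hypothesis g2 : mu.-integrable setT (EFin \o (fun x => g x ^+ 2)).

Lemma integrable_mul_sqr : mu.-integrable setT (EFin \o (fun x => f x * g x)).
Proof.
apply: (integrable_le (g := fun x => f x ^+ 2 + g x ^+ 2)) => //.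
- exact: measurable_funM.
- exact: integrable_addr.
move=> x _; rewrite normrM -[f x ^+ 2]real_normK ?num_real//.
rewrite -[g x ^+ 2]real_normK ?num_real//; nra.
Qed.

Lemma Rintegral_cauchy_schwarz :
  `|\int[mu]_x (f x * g x)| <=
  Num.sqrt (\int[mu]_x (f x ^+ 2)) * Num.sqrt (\int[mu]_x (g x ^+ 2)).
Proof.
apply: (le_trans (le_normr_Rintegral measurableT integrable_mul_sqr)).
have := @hoelder _ _ _ mu f g 2 2 mf mg.
rewrite !L2normE// Lnorm1 -EFinM => h.
have {}h : (\int[mu]_x `|f x * g x|%:E <=
    (Num.sqrt (\int[mu]_x (f x ^+ 2)) * Num.sqrt (\int[mu]_x (g x ^+ 2)))%:E)%E.
  by apply: h => //; lra.
rewrite -lee_fin; apply: le_trans h.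
rewrite /Rintegral fineK//.
by apply: integrable_fin_num => //; exact: integrable_normr integrable_mul_sqr.
Qed.

End CauchySchwarz.

Section Cells.
Context (R : realType).
Notation mu := (@lebesgue_measure R).
Variables (N : nat).
Hypothesis N0 : (0 < N)%N.

Let NR0 : (0 : R) < N%:R. Proof. by rewrite ltr0n. Qed.

Lemma cell_itv i : @cell R N i = `[i%:R / N%:R, i.+1%:R / N%:R[%classic.
Proof. by apply/seteqP; split => x /=; rewrite in_itv. Qed.

Lemma measurable_cell i : measurable (@cell R N i).
Proof. by rewrite cell_itv. Qed.

Lemma lebesgue_cell i : mu (@cell R N i) = (N%:R^-1)%:E.
Proof.
have h : (i%:R / N%:R : R) < i.+1%:R / N%:R.
  by rewrite ltr_pM2r ?invr_gt0// ltr_nat.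
rewrite cell_itv lebesgue_measure_itv /= lte_fin h -EFinB -mulrBl -natrB//.
by rewrite subSnn mul1r.
Qed.

Lemma sub_cell_I01 (i : 'I_N) : @cell R N i `<=` @I01 R.
Proof.
move=> x /= /andP[h1 h2]; rewrite /I01 /= in_itv /=; apply/andP; split.
  by apply: le_trans h1; rewrite divr_ge0.
apply/ltW/(lt_le_trans h2).
by rewrite ler_pdivrMr// mul1r ler_nat.
Qed.

Lemma cell_inj i j (x : R) : @cell R N i x -> @cell R N j x -> i = j.
Proof.
move=> /= /andP[i1 i2] /andP[j1 j2].
have := le_lt_trans i1 j2; have := le_lt_trans j1 i2.
rewrite !ltr_pM2r ?invr_gt0// !ltr_nat !ltnS => h1 h2.
by apply/eqP; rewrite eqn_leq h1 h2.
Qed.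

Lemma integrable_cst_cell i (c : R) :
  mu.-integrable (@cell R N i) (EFin \o (fun=> c)).
Proof.
have -> : EFin \o (fun=> c) = EFin \o cst c :> (R -> \bar R) by [].
apply: measurable_bounded_integrable; first exact: measurable_cell.
- by rewrite [ltLHS]lebesgue_cell ltry.
- exact: measurable_cst.
- exact: bounded_cst.
Qed.

Lemma Rintegral_cst_cell i (c : R) : \int[mu]_(x in @cell R N i) c = c / N%:R.
Proof.
rewrite Rintegral_cst; last exact: measurable_cell.
by rewrite [X in fine X]lebesgue_cell.
Qed.

Definition step (a : 'I_N -> R) (x : R) : R :=
  \sum_(j < N) a j * \1_(@cell R N j) x.

Lemma step_cell (a : 'I_N -> R) (i : 'I_N) x : @cell R N i x -> step a x = a i.
Proof.
move=> ix; rewrite /step (bigD1 i)//= indicE mem_set// mulr1 big1 ?addr0//.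
move=> j ji; rewrite indicE memNset ?mulr0// => jx.
by move/eqP: ji; apply; apply/val_inj; exact: cell_inj jx ix.
Qed.

Lemma step_out (a : 'I_N -> R) x :
  (forall j : 'I_N, ~ @cell R N j x) -> step a x = 0.
Proof.
move=> h; rewrite /step big1// => j _; rewrite indicE memNset ?mulr0//.
Qed.

Lemma step_le (a : 'I_N -> R) c x : 0 <= c -> (forall j, `|a j| <= c) ->
  `|step a x| <= c.
Proof.
move=> c0 ac; have [[j jx]|h] := pselect (exists j : 'I_N, @cell R N j x).
  by rewrite (step_cell _ jx).
by rewrite step_out ?normr0// => j jx; apply: h; exists j.
Qed.

Lemma measurable_step a : measurable_fun setT (step a).
Proof.
rewrite /step; apply: measurable_sum => j; apply: measurable_funM => //.
by apply: measurable_indic; exact: measurable_cell.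
Qed.

Lemma Psi_step (W : 'M[R]_N) x y :
  Psi W (x, y) = step (fun i => step (W i) y) x.
Proof.
rewrite /Psi /step /=; apply: eq_bigr => i _; rewrite mulr_suml.
by apply: eq_bigr => j _; rewrite -!mulrA [\1_(cell _ i) _ * _]mulrC.
Qed.

Lemma measurable_Psi (W : 'M[R]_N) : measurable_fun setT (Psi W).
Proof.
rewrite /Psi; apply: measurable_sum => i; apply: measurable_sum => j.
apply: measurable_funM; [apply: measurable_funM => //|];
  by apply: measurableT_comp => //; apply: measurable_indic; exact: measurable_cell.
Qed.

Lemma Psi_sqr (W : 'M[R]_N) z :
  Psi W z ^+ 2 = Psi (\matrix_(i, j) (W i j ^+ 2)) z.
Proof.
case: z => x y; rewrite !Psi_step.
have [[i ix]|h] := pselect (exists j : 'I_N, @cell R N j x); last first.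
  by rewrite !step_out ?expr0n//= => j jx; apply: h; exists j.
rewrite !(step_cell _ ix).
have [[j jy]|h] := pselect (exists j : 'I_N, @cell R N j y); last first.
  by rewrite !step_out ?expr0n//= => j jx; apply: h; exists j.
by rewrite !(step_cell _ jy) mxE.
Qed.

Lemma Psi_support (W : 'M[R]_N) : Psi W \_ (@I01 R `*` @I01 R) = Psi W.
Proof.
apply/funext => -[x y]; rewrite patchE; case: ifPn => //.
move=> /negP; rewrite inE => h; apply/esym; rewrite Psi_step.
have [[i ix]|h'] := pselect (exists j : 'I_N, @cell R N j x); last first.
  by rewrite step_out// => j jx; apply: h'; exists j.
rewrite (step_cell _ ix) step_out// => j jy; apply: h.
by split; [exact: sub_cell_I01 ix|exact: sub_cell_I01 jy].
Qed.

Notation mu2 := ((@lebesgue_measure R) \x (@lebesgue_measure R))%E.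

Let indic2 (i j : 'I_N) (z : R * R) :
  \1_(@cell R N i) z.1 * \1_(@cell R N j) z.2 =
  \1_(@cell R N i `*` @cell R N j) z :> R.
Proof. by rewrite !indicE in_setX -natrM mulnb. Qed.

Let mcell2 i j : measurable (@cell R N i `*` @cell R N j).
Proof. by apply: measurableX; exact: measurable_cell. Qed.

Let indic2i (i j : 'I_N) :
  mu2.-integrable setT (EFin \o (\1_(@cell R N i `*` @cell R N j) : R * R -> R)).
Proof.
apply/integrableP; split.
  by apply/measurable_EFinP/measurable_indic; exact: mcell2.
under eq_integral do rewrite gee0_abs ?lee_fin//.
rewrite integral_indic ?setIT; [|by []|exact: mcell2].
rewrite [ltLHS]product_measure1E; [|exact: measurable_cell..].
by rewrite ![X in (X * _)%E]lebesgue_cell [X in (_ * X)%E]lebesgue_cell -EFinM ltry.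
Qed.

Lemma integrable_Psi (W : 'M[R]_N) : mu2.-integrable setT (EFin \o Psi W).
Proof.
apply: integrable_sumr => // i _; apply: integrable_sumr => // j _.
have := integrable_mulrl (W i j) measurableT (indic2i i j).
apply: eq_integrable => // z _ /=.
by rewrite -mulrA indic2.
Qed.

Lemma Rintegral_Psi (W : 'M[R]_N) :
  \int[mu2]_z Psi W z = (N%:R ^+ 2)^-1 * \sum_(i < N) \sum_(j < N) W i j.
Proof.
have ij (i j : 'I_N) : mu2.-integrable setT
    (EFin \o (fun z => W i j * \1_(@cell R N i) z.1 * \1_(@cell R N j) z.2)).
  have := integrable_mulrl (W i j) measurableT (indic2i i j).
  by apply: eq_integrable => // z _ /=; rewrite -mulrA indic2.
rewrite /Psi Rintegral_sum//; last first.
  by move=> i _; apply: integrable_sumr.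
rewrite mulr_sumr; apply: eq_bigr => i _.
rewrite Rintegral_sum// mulr_sumr; apply: eq_bigr => j _.
under eq_Rintegral do rewrite -mulrA indic2.
rewrite RintegralZl// [RHS]mulrC; congr (_ * _).
rewrite /Rintegral integral_indic ?setIT; [|by []|exact: mcell2].
rewrite [X in fine X]product_measure1E; [|exact: measurable_cell..].
by rewrite [X in (X * _)%E]lebesgue_cell [X in (_ * X)%E]lebesgue_cell -EFinM /= expr2 invfM.
Qed.

Lemma normL2II_Psi (W : 'M[R]_N) :
  normL2II (Psi W) =
  (Num.sqrt ((N%:R ^+ 2)^-1 * \sum_(i < N) \sum_(j < N) W i j ^+ 2))%:E.
Proof.
rewrite /normL2II Psi_support L2normE; last 2 first.
- exact: measurable_Psi.
- under [X in EFin \o X]funext do rewrite Psi_sqr.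
  exact: integrable_Psi.
under eq_Rintegral do rewrite Psi_sqr.
rewrite Rintegral_Psi; congr (Num.sqrt (_ * _))%:E.
by apply: eq_bigr => i _; apply: eq_bigr => j _; rewrite mxE.
Qed.

Lemma muNE (g : R -> R) (i : 'I_N) :
  mu.-integrable (@I01 R) (EFin \o g) ->
  muN g i = N%:R * \int[mu]_(x in @cell R N i) g x.
Proof.
move=> gi; rewrite /muN cell_itv -Rintegral_itv_bndo_bndc//.
rewrite -cell_itv; apply: (integrableS _ _ _ gi).
- by rewrite /I01; exact: measurable_itv.
- exact: measurable_cell.
- exact: sub_cell_I01.
Qed.

End Cells.

(** * Step graphons close in cut norm *)

Section Close.
Context (R : realType).
Notation mu := (@lebesgue_measure R).
Notation mu2 := ((@lebesgue_measure R) \x (@lebesgue_measure R))%E.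
Notation I01 := (@I01 R).

Let mI01 : measurable I01. Proof. by rewrite /Defs.I01; exact: measurable_itv. Qed.

Let mI2 : measurable (I01 `*` I01). Proof. exact: measurableX. Qed.

Let muI01 : mu I01 = 1%E.
Proof.
by rewrite /Defs.I01 lebesgue_measure_itv /= lte_fin ltr01 oppr0 adde0.
Qed.

Variables (w : R * R -> R) (zeta : R).
Hypothesis hw : graphon w.
Hypothesis hwrow : (ereal_sup [set normL2I (fun y => w (x, y)) | x in I01]
              <= zeta%:E)%E.

(** Extending by 0 makes integrals over the unit square integrals over the plane. *)
Definition graphon_ext : R * R -> R := w \_ (I01 `*` I01).

Let mext : measurable_fun setT graphon_ext.
Proof. by have [_ /Lfun2P[]] := hw. Qed.

Let mext_row x : measurable_fun setT (fun y => graphon_ext (x, y)).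
Proof. exact: measurable_fun_pair2 mext. Qed.

Lemma integrable_graphon_ext : mu2.-integrable setT (EFin \o graphon_ext).
Proof.
have [_ /Lfun2P[_ w2]] := hw.
apply/integrable_restrictP => //.
have mwD : measurable_fun (I01 `*` I01) w.
  by apply/measurable_restrictT => //; exact: mext.
apply: integrable_of_sqr => //.
  by rewrite [ltLHS]product_measure1E// [X in (X * _)%E]muI01 mul1e [ltLHS]muI01 ltry.
apply/integrable_restrictP => //.
apply: eq_integrable w2 => // z _ /=.
by rewrite !patchE; case: ifP => //; rewrite expr0n.
Qed.

Lemma zeta_ge0 : 0 <= zeta.
Proof.
rewrite -lee_fin; apply: le_trans hwrow.
apply: (@le_trans _ _ (normL2I (fun y => w (0, y)))); first exact: Lnorm_ge0.
apply: ereal_sup_ubound; exists 0 => //.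
by rewrite /Defs.I01 /= in_itv /= lexx ler01.
Qed.

Let row_eq x : I01 x -> (fun y => w (x, y)) \_ I01 = (fun y => graphon_ext (x, y)).
Proof.
move=> Ix; apply/funext => y; rewrite /graphon_ext !patchE.
by rewrite in_setX /= (mem_set Ix).
Qed.

Lemma row_sqr x : I01 x ->
  mu.-integrable setT (EFin \o (fun y => graphon_ext (x, y) ^+ 2)) /\
  Num.sqrt (\int[mu]_y (graphon_ext (x, y) ^+ 2)) <= zeta.
Proof.
move=> Ix.
have h : ('N[mu]_2%:E [EFin \o (fun y => graphon_ext (x, y))] <= zeta%:E)%E.
  apply: le_trans hwrow; apply: ereal_sup_ubound; exists x => //.
  by rewrite /normL2I row_eq.
have /Lfun2P[_ i2] : (fun y => graphon_ext (x, y)) \in Lfun mu 2%:E.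
  rewrite inE; apply/andP; split; first by rewrite inE; exact: mext_row.
  by rewrite inE /= /finite_norm (le_lt_trans h) ?ltry.
by split => //; rewrite -lee_fin -(L2normE (mu:=mu) (mext_row x) i2).
Qed.

Lemma integrable_row x : I01 x -> mu.-integrable setT (EFin \o (fun y => graphon_ext (x, y))).
Proof.
move=> Ix; have [i2 _] := row_sqr Ix.
have -> : (fun y => graphon_ext (x, y)) = (fun y => graphon_ext (x, y)) \_ I01.
  apply/funext => y; rewrite !patchE; case: ifPn => // yI.
  by rewrite /graphon_ext patchE in_setX /= (negbTE yI) andbF.
apply/integrable_restrictP => //.
apply: integrable_of_sqr => //.
- by rewrite [ltLHS]muI01 ltry.
- exact: measurable_funS (mext_row x).
- by apply: integrableS i2.
Qed.

Lemma graphon_op_ext (h : R -> R) x : I01 x ->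
  graphon_op w h x = \int[mu]_y (graphon_ext (x, y) * h y).
Proof.
move=> Ix; rewrite /graphon_op Rintegral_mkcond; apply: eq_Rintegral => y _.
have /= <- := congr1 (fun h => h y) (row_eq Ix).
by rewrite !patchE; case: ifP => // _; rewrite mul0r.
Qed.

Variables (N : nat) (W : 'M[R]_N) (gamma : R).
Hypothesis N0 : (0 < N)%N.
Hypothesis hcut : (cutnorm (fun p => Psi W p - w p)%R <= gamma%:E)%E.

Let NR0 : (0 : R) < N%:R. Proof. by rewrite ltr0n. Qed.

Let k z := Psi W z - graphon_ext z.

Let ki : mu2.-integrable setT (EFin \o k).
Proof. by apply: integrable_subr => //; [exact: integrable_Psi|exact: integrable_graphon_ext]. Qed.

Let kcut (S U : set R) : measurable S -> measurable U ->
  `|\int[mu2]_z (k z * \1_S z.1 * \1_U z.2)| <= gamma.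
Proof.
move=> mS mU.
have mSI : measurable (S `&` I01) by exact: measurableI.
have mUI : measurable (U `&` I01) by exact: measurableI.
have mX : measurable ((S `&` I01) `*` (U `&` I01)) by exact: measurableX.
have kX : mu2.-integrable ((S `&` I01) `*` (U `&` I01)) (EFin \o k).
  by apply: integrableS ki.
have -> : \int[mu2]_z (k z * \1_S z.1 * \1_U z.2) =
          \int[mu2]_(z in (S `&` I01) `*` (U `&` I01)) k z.
  rewrite [RHS]Rintegral_mkcond; apply: eq_Rintegral => -[x y] _.
  rewrite patchE !indicE /= in_setX /= !in_setI.
  have -> : k (x, y) = k (x, y) * ((x \in I01) && (y \in I01))%:R.
    have -> : (x \in I01) && (y \in I01) = ((x, y) \in I01 `*` I01).
      by rewrite in_setX.
    rewrite /k -Psi_support// /graphon_ext !patchE.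
    by case: (_ \in _); rewrite ?mulr1// subrr mul0r.
  by case: (x \in S); case: (x \in I01); case: (y \in U); case: (y \in I01);
    rewrite /= ?(mulr0, mul0r, mulr1).
rewrite -lee_fin EFin_normr_Rintegral//; apply: le_trans hcut.
apply: ereal_sup_ubound; exists (S `&` I01), (U `&` I01); split => //.
congr (`| _ |)%E; apply: eq_integral => -[x y] /set_mem[/= [_ Ix] [_ Iy]].
by rewrite /k /graphon_ext patchE mem_set.
Qed.

Lemma gamma_ge0 : 0 <= gamma.
Proof. by apply: le_trans (normr_ge0 _) (kcut measurable0 measurable0). Qed.

Definition avg_op (phi : R -> R) (i : 'I_N) : R :=
  \sum_(j < N) W i j * \int[mu]_(y in cell N j) phi y.

Section Bounded.
Variables (phi : R -> R) (c : R).
Hypothesis mphi : measurable_fun setT phi.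
Hypothesis c0 : 0 <= c.
Hypothesis phic : forall y, `|phi y| <= c.

Lemma integrable_bounded_cell (j : 'I_N) :
  mu.-integrable (cell N j) (EFin \o phi).
Proof.
apply: (integrable_le (g := fun=> c)) => //; first exact: measurable_cell.
- exact: measurable_funS mphi.
- exact: integrable_cst_cell.
Qed.

Let kphi_cell (i : 'I_N) x : cell N i x ->
  \int[mu]_y (k (x, y) * phi y) =
  avg_op phi i - \int[mu]_y (graphon_ext (x, y) * phi y).
Proof.
move=> ix; have Ix := sub_cell_I01 N0 ix.
have ij (j : 'I_N) : mu.-integrable setT
    (EFin \o (fun y => W i j * (phi y * \1_(cell N j) y))).
  apply: integrable_mulrl => //.
  have -> : (fun y => phi y * \1_(cell N j) y) = phi \_ (cell N j).
    by apply/funext => y; rewrite patchE indicE; case: (_ \in _);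
      rewrite ?mulr1 ?mulr0.
  apply/integrable_restrictP; first exact: measurable_cell.
  exact: integrable_bounded_cell.
have -> : \int[mu]_y (k (x, y) * phi y) = \int[mu]_y
    (\sum_(j < N) W i j * (phi y * \1_(cell N j) y) - graphon_ext (x, y) * phi y).
  apply: eq_Rintegral => y _; rewrite /k mulrBl Psi_step (step_cell _ _ ix)//.
  congr (_ - _); rewrite /step mulr_suml; apply: eq_bigr => j _; ring.
rewrite RintegralB//; last 2 first.
- exact: integrable_sumr.
- by apply: (integrable_mul_bounded (c := c)) => //; exact: integrable_row.
congr (_ - _); rewrite Rintegral_sum//; apply: eq_bigr => j _.
rewrite RintegralZl ?Rintegral_indic_mulr//.
have -> : (fun y => phi y * \1_(cell N j) y) = phi \_ (cell N j).
  by apply/funext => y; rewrite patchE indicE; case: (_ \in _);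
    rewrite ?mulr1 ?mulr0.
apply/integrable_restrictP; first exact: measurable_cell.
exact: integrable_bounded_cell.
Qed.

Lemma integrable_avg_op_close (i : 'I_N) : mu.-integrable (cell N i) (EFin \o
  (fun x => `|avg_op phi i - \int[mu]_y (graphon_ext (x, y) * phi y)|)).
Proof.
have h : mu.-integrable (cell N i)
    (EFin \o (fun x => `|\int[mu]_y (k (x, y) * phi y)|)).
  apply: integrable_normr; first exact: measurable_cell.
  apply: integrableS (integrable_cut_apply ki mphi phic) => //.
  exact: measurable_cell.
apply: eq_integrable h; first exact: measurable_cell.
by move=> x /set_mem ix /=; rewrite (kphi_cell ix).
Qed.

(** On the cell of player [i] the step operator is constant, so the cut-norm bound,
    which is an L^1 bound on the whole interval, costs a factor [N] after
    averaging over one cell: this is where a cut distance [o(1/N)] is needed. *)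
Lemma avg_op_close (i : 'I_N) :
  N%:R * \int[mu]_(x in cell N i)
     `|avg_op phi i - \int[mu]_y (graphon_ext (x, y) * phi y)| <=
  4 * c * (N%:R * gamma).
Proof.
rewrite mulrCA; apply: ler_wpM2l; first exact: ltW.
apply: le_trans (cutnorm_op_bound ki kcut mphi c0 phic).
rewrite Rintegral_mkcond.
have ci := integrable_normr measurableT (integrable_cut_apply ki mphi phic).
apply: le_Rintegral => //.
  apply/integrable_restrictP; first exact: measurable_cell.
  exact: integrable_avg_op_close.
move=> x _; rewrite patchE; case: ifPn => [/set_mem ix|_]; last exact: normr_ge0.
by rewrite (kphi_cell ix).
Qed.

End Bounded.

(** Test the previous bound against the signs of the entries of row [i]
    supported on the cells of [T]: the graphon side is at most
    [zeta * sqrt (#|T| / N)] by Cauchy-Schwarz on the rows of [w]. *)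
Lemma row_mass (i : 'I_N) (T : {set 'I_N}) :
  N%:R^-1 * \sum_(j in T) `|W i j| <=
  4 * (N%:R * gamma) + zeta * Num.sqrt (#|T|%:R / N%:R).
Proof.
pose a j : R := if j \in T then Num.sg (W i j) else 0.
have a1 j : `|a j| <= 1.
  rewrite /a; case: ifP => _; rewrite ?normr0// normr_sg.
  by case: (_ == _).
pose s := @step R N a.
have ms : measurable_fun setT s by exact: measurable_step.
have s1 y : `|s y| <= 1 by exact: step_le.
have vE : avg_op s i = N%:R^-1 * \sum_(j in T) `|W i j|.
  rewrite /avg_op mulr_sumr [RHS]big_mkcond; apply: eq_bigr => j _.
  have -> : \int[mu]_(y in cell N j) s y = \int[mu]_(y in cell N j) a j.
    by apply: eq_Rintegral => y /set_mem jy; rewrite /s (step_cell _ _ jy).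
  rewrite Rintegral_cst_cell// /a; case: ifP => _; last by rewrite mul0r mulr0.
  by rewrite mulrA [W i j * _]mulrC -normrEsg mulrC.
have s2 y : s y ^+ 2 = step (fun j => ((j \in T)%:R * `|a j|)) y.
  have [[j jy]|h] := pselect (exists j : 'I_N, cell N j y); last first.
    by rewrite /s !step_out ?expr0n//= => j jy; apply: h; exists j.
  rewrite /s !(step_cell _ _ jy)// /a; case: ifP => _; last by rewrite mul0r expr0n.
  by rewrite mul1r normr_sg sqr_sg; case: (_ == _).
have istep (u : 'I_N -> R) (j : 'I_N) :
    mu.-integrable setT (EFin \o (fun y => u j * \1_(cell N j) y)).
  apply: integrable_mulrl => //.
  have -> : (\1_(cell N j) : R -> R) = ((fun=> 1) : R -> R) \_ (cell N j).
    by apply/funext => y; rewrite patchE indicE; case: (_ \in _).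
  apply/integrable_restrictP; first exact: measurable_cell.
  exact: integrable_cst_cell.
have is2 : mu.-integrable setT (EFin \o (fun y => s y ^+ 2)).
  under [X in EFin \o X]funext do rewrite s2.
  apply: integrable_sumr => // j _. exact: (istep (fun j => (j \in T)%:R * `|a j|) j).
have ns2 : \int[mu]_y (s y ^+ 2) <= #|T|%:R / N%:R.
  under eq_Rintegral do rewrite s2.
  rewrite Rintegral_sum//; last first.
    by move=> j _; exact: (istep (fun j => (j \in T)%:R * `|a j|) j).
  have e (j : 'I_N) : \int[mu]_y ((j \in T)%:R * `|a j| * \1_(cell N j) y) =
      (j \in T)%:R * `|a j| / N%:R.
    rewrite RintegralZl//; last first.
      by have := istep (fun=> 1) j; apply: eq_integrable => // y _ /=; rewrite mul1r.
    under eq_Rintegral do rewrite -[\1__ _]mul1r.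
    by rewrite Rintegral_indic_mulr Rintegral_cst_cell// mul1r.
  under eq_bigr do rewrite e.
  rewrite -mulr_suml; apply: ler_wpM2r; first by rewrite invr_ge0 ltW.
  rewrite -sum1_card natr_sum [leRHS]big_mkcond; apply: ler_sum => j _.
  by case: ifP => _; rewrite ?mul0r ?mul1r.
have hx x : cell N i x -> avg_op s i <=
    `|avg_op s i - \int[mu]_y (graphon_ext (x, y) * s y)| +
    zeta * Num.sqrt (#|T|%:R / N%:R).
  move=> ix; have Ix := sub_cell_I01 N0 ix.
  have [i2 iz] := row_sqr Ix.
  have h := Rintegral_cauchy_schwarz (mu := mu) (mext_row x) ms i2 is2.
  have h2 : `|\int[mu]_y (graphon_ext (x, y) * s y)| <= zeta * Num.sqrt (#|T|%:R / N%:R).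
    apply: (le_trans h); apply: ler_pM; rewrite ?sqrtr_ge0//.
    by rewrite ler_wsqrtr.
  apply: le_trans (lerD (lexx _) h2).
  rewrite (le_trans (ler_norm _))// -[X in `|X| <= _](subrK (\int[mu]_y (graphon_ext (x, y) * s y))).
  exact: ler_normD.
have h := avg_op_close ms ler01 s1 i.
rewrite mulr1 in h; rewrite -vE.
have -> : avg_op s i = N%:R * \int[mu]_(x in cell N i) avg_op s i.
  by rewrite Rintegral_cst_cell// mulrC divfK// gt_eqF.
have -> : zeta * Num.sqrt (#|T|%:R / N%:R) =
   N%:R * \int[mu]_(x in cell N i) (zeta * Num.sqrt (#|T|%:R / N%:R)).
  by rewrite Rintegral_cst_cell// [RHS]mulrC divfK// gt_eqF.
apply: le_trans (lerD h (lexx _)); rewrite -mulrDr; apply: ler_wpM2l; first exact: ltW.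
rewrite -RintegralD//; last 3 first.
- exact: measurable_cell.
- exact: integrable_avg_op_close ms s1 i.
- exact: integrable_cst_cell.
apply: le_Rintegral => //; first exact: measurable_cell.
- exact: integrable_cst_cell.
- apply: integrable_addr; first exact: measurable_cell.
    exact: integrable_avg_op_close ms s1 i.
  exact: integrable_cst_cell.
Qed.

End Close.

(** * Averaging near-optimal actions *)

Section ActionSet.
Context (R : realType).
Variable A : set R.
Hypothesis A0 : A !=set0.
Hypothesis Aclosed : closed A.
Hypothesis Aconvex : convex_set (A : set (convex_lmodType R^o)).
Hypothesis Abounded : bounded_set A.

Lemma convex_set_conv (a b e : R) : A a -> A b -> 0 <= e <= 1 ->
  A (e * a + (1 - e) * b).
Proof.
move=> Aa Ab /andP[e0 e1]; apply: set_mem.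
exact: (@Aconvex a b (Itv01 e0 e1) (mem_set Aa) (mem_set Ab)).
Qed.

Lemma action_set_itv : exists lo hi : R, forall a, A a <-> lo <= a <= hi.
Proof.
have [M [Mr HM]] := Abounded.
have AM a : A a -> `|a| <= M + 1 by move=> Aa; apply: HM => //; rewrite ltrDl.
have usup (B : set R) : B !=set0 -> closed B -> (forall a, B a -> `|a| <= M + 1) ->
    B (sup B) /\ forall a, B a -> a <= sup B.
  move=> B0 cB BM.
  have uB : has_ubound B.
    by exists (M + 1) => a /BM; apply: le_trans; exact: ler_norm.
  split; first by have := closure_sup B0 uB; rewrite -(closure_id B).1.
  by move=> a Ba; exact: ub_le_sup.
pose B : set R := -%R @^-1` A.
have B0 : B !=set0.
  by case: A0 => a Aa; exists (- a); rewrite /B /= opprK.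
have cB : closed B.
  by apply: closed_comp => // x _; exact: opp_continuous.
have [Ahi hiP] := usup A A0 Aclosed AM.
have [Blo loP] := usup B B0 cB (fun a Ba => ltac:(rewrite -normrN; exact: AM Ba)).
exists (- sup B), (sup A) => a; split.
  move=> Aa; rewrite hiP// andbT lerNl; apply: loP.
  by rewrite /B /= opprK.
move=> /andP[la ah].
have [e|lohi] := eqVneq (- sup B) (sup A).
  by have -> : a = sup A by apply/eqP; rewrite eq_le ah -e la.
have lt : - sup B < sup A by rewrite lt_neqAle lohi (le_trans la).
have -> : a = ((a + sup B) / (sup A + sup B)) * sup A +
   (1 - (a + sup B) / (sup A + sup B)) * - sup B.
  by field; rewrite gt_eqF//; lra.
apply: convex_set_conv => //.
have p : 0 < sup A + sup B by lra.
by rewrite ler_pdivlMr// mul0r ler_pdivrMr// mul1r; apply/andP; split; lra.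
Qed.

End ActionSet.

Section TangentLine.
Context (R : realType).
Variables (A : set R) (J J' : R -> R).
Hypothesis Aconv : forall a b e, A a -> A b -> 0 <= e <= 1 ->
  A (e * a + (1 - e) * b).
Hypothesis Jconv : forall a b e, A a -> A b -> 0 <= e <= 1 ->
  J (e * a + (1 - e) * b) <= e * J a + (1 - e) * J b.
Hypothesis J1 : C1_on A J J'.

(** The difference quotient along the segment from [a] to [b] is dominated by
    the full chord, and converges to the derivative at [a]. *)
Lemma convex_above_tangent (a b : R) : A a -> A b ->
  J a + J' a * (b - a) <= J b.
Proof.
move=> Aa Ab; have [->|ba] := eqVneq b a; first by rewrite subrr mulr0 addr0.
have [/(_ _ Aa) h _] := J1.
rewrite -lerBrDl.
have hb : (fun x => (b - a) * ((J x - J a) / (x - a))) @ within A a^' --> (b - a) * J' a.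
  by apply: cvgM h; exact: cvg_cst.
rewrite mulrC; apply/ler_addgt0Pr => e e0.
have /cvgrPdist_lt/(_ _ e0) := hb.
rewrite near_withinE /within /= /dnbhs near_withinE => /nbhs_ballP[r /= r0 hr].
pose t := Num.min 1 (r / (2 * `|b - a|)).
have nba : 0 < `|b - a| by rewrite normr_gt0 subr_eq0.
have t0 : 0 < t by rewrite lt_min ltr01 divr_gt0// mulr_gt0.
have t1 : t <= 1 by rewrite ge_min lexx.
have tr : t * `|b - a| < r.
  apply: (@le_lt_trans _ _ (r / (2 * `|b - a|) * `|b - a|)).
    by rewrite ler_wpM2r// ge_min lexx orbT.
  rewrite invfM mulrA mulfVK ?gt_eqF//; lra.
pose x := t * b + (1 - t) * a.
have xa : x - a = t * (b - a) by rewrite /x; ring.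
have Ax : A x by apply: Aconv => //; rewrite ltW.
have := hr x.
rewrite /ball /= -opprB normrN xa normrM (gtr0_norm t0) => /(_ tr).
have xna : x != a by rewrite -subr_eq0 xa mulf_neq0 ?(lt0r_neq0 t0)// subr_eq0.
move=> /(_ xna Ax) /= hlt.
have Jx : J x - J a <= t * (J b - J a).
  by have := Jconv Ab Aa (e := t); rewrite ltW//= t1 -/x => /(_ isT); lra.
have q : (b - a) * ((J x - J a) / (t * (b - a))) <= J b - J a.
  have -> : (b - a) * ((J x - J a) / (t * (b - a))) = (J x - J a) / t.
    have bna : b - a != 0 by rewrite subr_eq0.
    by field; rewrite bna (lt0r_neq0 t0).
  by rewrite ler_pdivrMr// mulrC.
move: hlt; rewrite ltr_norml => /andP[_ hlt]; lra.
Qed.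

End TangentLine.

Section AveragedAction.
Context d (T : measurableType d) (R : realType).
Variable mu : {measure set T -> \bar R}.
Variables (D : set T) (M : R).
Hypothesis mD : measurable D.
Hypothesis M0 : 0 < M.
Hypothesis muD : mu D = (M^-1)%:E.

Let cstI (c : R) : mu.-integrable D (EFin \o (fun=> c)).
Proof.
have -> : EFin \o (fun=> c) = EFin \o cst c :> (T -> \bar R) by [].
apply: measurable_bounded_integrable => //; last exact: bounded_cst.
by rewrite muD ltry.
Qed.

Lemma avg_cst (c : R) : M * \int[mu]_(x in D) c = c.
Proof. by rewrite Rintegral_cst// muD /= mulrC mulfVK// gt_eqF. Qed.

Lemma avg_le (f g : T -> R) : mu.-integrable D (EFin \o f) ->
  mu.-integrable D (EFin \o g) -> (\forall x \ae mu, D x -> f x <= g x) ->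
  M * \int[mu]_(x in D) f x <= M * \int[mu]_(x in D) g x.
Proof. by move=> fi gi fg; rewrite ler_wpM2l ?(ltW M0)//; exact: ae_le_Rintegral. Qed.

Lemma avg_affine (c k : R) (f : T -> R) : mu.-integrable D (EFin \o f) ->
  M * \int[mu]_(x in D) (c + k * f x) = c + k * (M * \int[mu]_(x in D) f x).
Proof.
move=> fi; rewrite RintegralD//; last exact: integrable_mulrl.
by rewrite mulrDr avg_cst RintegralZl// mulrCA.
Qed.

Lemma avg_distance (f g : T -> R) (c k e : R) :
  mu.-integrable D (EFin \o f) -> mu.-integrable D (EFin \o g) ->
  (\forall x \ae mu, D x -> `|c - f x| <= e + k * g x) ->
  `|c - M * \int[mu]_(x in D) f x| <= e + k * (M * \int[mu]_(x in D) g x).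
Proof.
move=> fi gi h.
have aff (u v : R) (F : T -> R) : mu.-integrable D (EFin \o F) ->
    mu.-integrable D (EFin \o (fun x => u + v * F x)).
  by move=> Fi; apply: integrable_addr => //; exact: integrable_mulrl.
have h1 : M * \int[mu]_(x in D) (- e + - k * g x) <=
          M * \int[mu]_(x in D) (c + - 1 * f x).
  apply: avg_le; [exact: aff|exact: aff|].
  by apply: filterS h => x hx Dx; have := hx Dx; rewrite ler_norml; lra.
have h2 : M * \int[mu]_(x in D) (c + - 1 * f x) <=
          M * \int[mu]_(x in D) (e + k * g x).
  apply: avg_le; [exact: aff|exact: aff|].
  by apply: filterS h => x hx Dx; have := hx Dx; rewrite ler_norml; lra.
rewrite !avg_affine// in h1 h2; rewrite ler_norml; lra.
Qed.

Variables (A : set R) (J J' : R -> R) (lc : R).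
Hypothesis A0 : A !=set0.
Hypothesis Aclosed : closed A.
Hypothesis Aconvex : convex_set (A : set (convex_lmodType R^o)).
Hypothesis Abounded : bounded_set A.
Hypothesis lc0 : 0 < lc.
Hypothesis Jconv : forall a b e, A a -> A b -> 0 <= e <= 1 ->
  J (e * a + (1 - e) * b) <= e * J a + (1 - e) * J b
     - lc / 2 * e * (1 - e) * `|a - b| ^+ 2.
Hypothesis J1 : C1_on A J J'.

Variables (al r : T -> R) (eta : R).
Hypothesis ali : mu.-integrable D (EFin \o al).
Hypothesis ri : mu.-integrable D (EFin \o r).
Hypothesis alA : \forall x \ae mu, D x -> A (al x).
Hypothesis alopt : \forall x \ae mu, D x -> forall a, A a -> J (al x) <= J a + r x.
Hypothesis reta : M * \int[mu]_(x in D) r x <= eta.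
Hypothesis eta0 : 0 < eta.

Let abar := M * \int[mu]_(x in D) al x.

Lemma avg_action_mem : A abar.
Proof.
have [lo [hi AE]] := action_set_itv A0 Aclosed Aconvex Abounded.
apply/AE; rewrite -[X in X <= abar]avg_cst -[X in _ && (_ <= X)]avg_cst.
by apply/andP; split; apply: avg_le => //; apply: filterS alA => x h Dx;
  have /AE/andP[] := h Dx.
Qed.

Let Jconv0 a b e : A a -> A b -> 0 <= e <= 1 ->
  J (e * a + (1 - e) * b) <= e * J a + (1 - e) * J b.
Proof.
move=> Aa Ab e01; apply: (le_trans (Jconv Aa Ab e01)); rewrite gerBl.
by move/andP: e01 => [e0 e1]; rewrite !mulr_ge0 ?subr_ge0 ?exprn_ge0// ltW.
Qed.

(** Jensen through the tangent line at the average: its linear term averages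
    to zero, so that near-optimality survives averaging. *)
Lemma avg_action_opt a : A a -> J abar <= J a + eta.
Proof.
move=> Aa; have Aab := avg_action_mem.
have -> : J abar = M * \int[mu]_(x in D) (J abar - J' abar * abar + J' abar * al x).
  by rewrite avg_affine// -/abar; ring.
apply: (@le_trans _ _ (M * \int[mu]_(x in D) (J a + 1 * r x))).
  apply: avg_le.
  - by apply: integrable_addr => //; exact: integrable_mulrl.
  - by apply: integrable_addr => //; exact: integrable_mulrl.
  - apply: filterS2 alA alopt => x h1 h2 Dx.
    rewrite mul1r; apply: le_trans (h2 Dx _ Aa).
    have := convex_above_tangent (convex_set_conv Aconvex) Jconv0 J1 Aab (h1 Dx).
    by rewrite mulrBr; lra.
by rewrite avg_affine// mul1r lerD2l.
Qed.

(** Two points that are both near-optimal for a strongly convex cost are close: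
    compare each with their midpoint.  The bound on the square is turned into a
    linear one by [x <= (x ^ 2 / s + s) / 2] with [s = sqrt eta]. *)
Lemma avg_action_near : \forall x \ae mu, D x ->
  `|abar - al x| <= (2 / lc + 2^-1) * Num.sqrt eta + 2 / lc / Num.sqrt eta * r x.
Proof.
apply: filterS2 alA alopt => x h1 h2 Dx.
have Ax := h1 Dx; have hx := h2 Dx; have Ab := avg_action_mem.
pose m := 2^-1 * abar + (1 - 2^-1) * al x.
have h01 : 0 <= (2^-1 : R) <= 1 by lra.
have Am : A m by exact: (convex_set_conv Aconvex).
have := Jconv Ab Ax h01; rewrite -/m => hm.
have m1 := avg_action_opt Am; have m2 := hx _ Am.
set y := `|abar - al x| in hm *.
set s := Num.sqrt eta.
have s0 : 0 < s by rewrite sqrtr_gt0.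
have ss : s ^+ 2 = eta by rewrite sqr_sqrtr// ltW.
have y0 : 0 <= y by exact: normr_ge0.
have hy : lc * y ^+ 2 <= 4 * (eta + r x).
  have -> : lc * y ^+ 2 = 8 * (lc / 2 * 2^-1 * (1 - 2^-1) * y ^+ 2) by field.
  lra.
have hy2 : y ^+ 2 / s <= 4 / lc * (s + r x / s).
  rewrite ler_pdivrMr//.
  have -> : 4 / lc * (s + r x / s) * s = 4 * (eta + r x) / lc.
    by rewrite -ss; field; rewrite !gt_eqF.
  by rewrite ler_pdivlMr// mulrC.
have : 2 * y <= y ^+ 2 / s + s.
  have -> : y ^+ 2 / s + s = 2 * y + (y - s) ^+ 2 / s by field; rewrite gt_eqF.
  by rewrite lerDl divr_ge0 ?sqr_ge0 ?ltW.
have -> : (2 / lc + 2^-1) * s + 2 / lc / s * r x =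
  (4 / lc * (s + r x / s) + s) / 2 by field; rewrite !gt_eqF.
lra.
Qed.

End AveragedAction.

(** * Existence and uniqueness of the finite-player state *)

Section FiniteSums.
Context (R : rcfType) (I : finType).

Lemma sum_cauchy_schwarz (a b : I -> R) :
  (\sum_i a i * b i) ^+ 2 <= (\sum_i a i ^+ 2) * (\sum_i b i ^+ 2).
Proof.
have : 0 <= \sum_i \sum_j (a i * b j - a j * b i) ^+ 2.
  by apply: sumr_ge0 => i _; apply: sumr_ge0 => j _; exact: sqr_ge0.
have -> : \sum_i \sum_j (a i * b j - a j * b i) ^+ 2 =
    \sum_i \sum_j (a i ^+ 2 * b j ^+ 2) + \sum_i \sum_j (b i ^+ 2 * a j ^+ 2)
    - 2 * \sum_i \sum_j ((a i * b i) * (a j * b j)).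
  rewrite mulr_sumr -!big_split -sumrB /=; apply: eq_bigr => i _.
  rewrite mulr_sumr -!big_split -sumrB /=; apply: eq_bigr => j _; ring.
rewrite -!big_distrlr /= expr2; set x := \sum_i a i ^+ 2; set y := \sum_i b i ^+ 2.
rewrite (mulrC y x); lra.
Qed.

Lemma sum_weighted_jensen (p x : I -> R) : (forall i, 0 <= p i) ->
  (\sum_i p i * x i) ^+ 2 <= (\sum_i p i) * (\sum_i p i * x i ^+ 2).
Proof.
move=> p0.
have := sum_cauchy_schwarz (fun i => Num.sqrt (p i)) (fun i => Num.sqrt (p i) * x i).
under eq_bigr do rewrite mulrA -expr2 sqr_sqrtr//.
under [X in _ <= X * _ -> _]eq_bigr do rewrite sqr_sqrtr//.
by under [X in _ <= _ * X -> _]eq_bigr do rewrite exprMn sqr_sqrtr//.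
Qed.

End FiniteSums.

Section Lipschitz.
Context (R : realType).
Variables (h : R -> R) (c : R).
Hypothesis c0 : 0 <= c.
Hypothesis hlip : forall z z', `|h z - h z'| ^+ 2 <= c * `|z - z'| ^+ 2.

Lemma sqr_lipschitz_norm z z' : `|h z - h z'| <= Num.sqrt c * `|z - z'|.
Proof.
rewrite -(@ler_pXn2r _ 2)// ?nnegrE ?mulr_ge0 ?sqrtr_ge0//.
by rewrite exprMn sqr_sqrtr.
Qed.

Lemma sqr_lipschitz_continuous : continuous h.
Proof.
move=> z; apply/cvgrPdist_lt => e e0; near=> y.
apply: le_lt_trans (sqr_lipschitz_norm z y) _.
apply: (@le_lt_trans _ _ ((Num.sqrt c + 1) * `|z - y|)).
  by rewrite ler_wpM2r// lerDl.
rewrite mulrC -ltr_pdivlMr; last by rewrite ltr_wpDl// sqrtr_ge0.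
near: y; apply: (@cvgr_dist_lt _ _ _ _ _ id); first exact: cvg_id.
by rewrite divr_gt0// ltr_wpDl// sqrtr_ge0.
Unshelve. all: by end_near. Qed.

End Lipschitz.

Section Picard.
Context (R : realType) (N : nat).
Variables (W : 'M[R]_N) (h : 'I_N -> R -> R) (cz : R).
Hypothesis cz0 : 0 <= cz.
Hypothesis hlip : forall j z z', `|h j z - h j z'| ^+ 2 <= cz * `|z - z'| ^+ 2.

Let r : R := cz * ((N%:R ^+ 2)^-1 * \sum_(i < N) \sum_(j < N) W i j ^+ 2).
Hypothesis r1 : r < 1.

Definition state_map (x z : 'I_N -> R) (i : 'I_N) : R :=
  N%:R^-1 * \sum_(j < N) W i j * (h j (z j) + x j).

Lemma state_map_contract x z z' :
  \sum_i (state_map x z i - state_map x z' i) ^+ 2 <=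
  r * \sum_i (z i - z' i) ^+ 2.
Proof.
have -> : r * \sum_i (z i - z' i) ^+ 2 =
  \sum_(i < N) ((N%:R ^+ 2)^-1 * ((\sum_(j < N) W i j ^+ 2) *
     (cz * \sum_i (z i - z' i) ^+ 2))).
  by rewrite -mulr_sumr -mulr_suml /r; ring.
apply: ler_sum => i _.
rewrite /state_map -mulrBr -sumrB exprMn -exprVn.
apply: ler_wpM2l; first by rewrite exprn_ge0// invr_ge0.
under eq_bigr => j _ do rewrite -mulrBr opprD addrACA subrr addr0.
apply: (le_trans (sum_cauchy_schwarz _ _)).
apply: ler_wpM2l; first by apply: sumr_ge0 => j _; exact: sqr_ge0.
rewrite mulr_sumr; apply: ler_sum => j _.
by have := hlip j (z j) (z' j); rewrite !real_normK ?num_real.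
Qed.

Let r0 : 0 <= r.
Proof.
rewrite mulr_ge0// mulr_ge0 ?invr_ge0 ?exprn_ge0//.
by apply: sumr_ge0 => i _; apply: sumr_ge0 => j _; exact: sqr_ge0.
Qed.

Lemma state_map_fixed_unique x z z' :
  (forall i, z i = state_map x z i) -> (forall i, z' i = state_map x z' i) ->
  forall i, z i = z' i.
Proof.
move=> hz hz' i.
have := state_map_contract x z z'.
have -> : \sum_i (state_map x z i - state_map x z' i) ^+ 2 =
          \sum_i (z i - z' i) ^+ 2.
  by apply: eq_bigr => j _; rewrite -hz -hz'.
set S := \sum_i _ => hS.
have S0 : 0 <= S by apply: sumr_ge0 => j _; exact: sqr_ge0.
have {hS}S0' : S = 0.
  by apply/eqP; rewrite eq_le S0 andbT; move: r1 hS; nra.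
have /eqP : (z i - z' i) ^+ 2 = 0.
  move: S0' => /eqP; rewrite psumr_eq0; last by move=> j _; exact: sqr_ge0.
  by move=> /allP /(_ i (mem_index_enum _)) /eqP.
by rewrite sqrf_eq0 subr_eq0 => /eqP.
Qed.

Fixpoint picard (x : 'I_N -> R) (k : nat) : 'I_N -> R :=
  if k is k'.+1 then state_map x (picard x k') else fun=> 0.

Let picard_step x k :
  \sum_i (picard x k.+1 i - picard x k i) ^+ 2 <=
  r ^+ k * \sum_i (picard x 1 i - picard x 0 i) ^+ 2.
Proof.
elim: k => [|k IH]; first by rewrite expr0 mul1r.
apply: (le_trans (state_map_contract x (picard x k.+1) (picard x k))).
by rewrite exprS -mulrA ler_wpM2l.
Qed.

Lemma cvg_picard x i : cvgn (fun k => picard x k i).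
Proof.
pose u k := picard x k.+1 i - picard x k i.
have -> : (fun k => picard x k i) = series u.
  apply/funext => k; rewrite /series /= /u.
  by rewrite telescope_sumr// /= subr0.
apply: normed_cvg.
pose S := \sum_i (picard x 1 i - picard x 0 i) ^+ 2.
apply: (@series_le_cvg _ _ (geometric (Num.sqrt S) (Num.sqrt r))) => //.
- by move=> k /=.
- by move=> k; rewrite /geometric /= mulr_ge0// ?exprn_ge0 ?sqrtr_ge0//.
- move=> k; rewrite /geometric /=.
  rewrite -(@ler_pXn2r _ 2)// ?nnegrE ?mulr_ge0 ?exprn_ge0 ?sqrtr_ge0//.
  have S0 : 0 <= S by apply: sumr_ge0 => j _; exact: sqr_ge0.
  rewrite real_normK ?num_real// exprMn sqr_sqrtr// -exprM mulnC exprM sqr_sqrtr//.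
  rewrite mulrC; apply: le_trans (picard_step x k).
  by rewrite (bigD1 i)//= lerDl; apply: sumr_ge0 => j _; exact: sqr_ge0.
- apply: is_cvg_geometric_series; rewrite ger0_norm ?sqrtr_ge0//.
  by rewrite -[ltRHS]sqrtr1 ltr_sqrt.
Qed.

Definition state (x : 'I_N -> R) (i : 'I_N) : R := limn (fun k => picard x k i).

Lemma stateE x i : state x i = state_map x (state x) i.
Proof.
have hcvg j : picard x k j @[k --> \oo] --> state x j by exact: cvg_picard.
have h1 : picard x k.+1 i @[k --> \oo] --> state x i.
  by rewrite (cvg_shiftS (fun k => picard x k i)); exact: hcvg.
apply: (cvg_unique _ h1) => //=.
apply: cvgM; first exact: cvg_cst.
apply: cvg_big => [|j _]; [exact: add_continuous|]; apply: cvgM; first exact: cvg_cst.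
apply: cvgD; last exact: cvg_cst.
by apply: (cvg_comp _ _ (hcvg j)); exact: (sqr_lipschitz_continuous cz0 (hlip j)).
Qed.

Lemma measurable_state d (Omega : measurableType d) (xi : 'I_N -> Omega -> R) i :
  (forall j, measurable_fun setT (xi j)) ->
  measurable_fun setT (fun omega => state (xi ^~ omega) i).
Proof.
move=> mxi.
apply: (@measurable_fun_cvg _ _ _ _ (fun k omega => picard (xi ^~ omega) k i)).
  move=> k; elim: k i => [|k IH] i /=; first exact: measurable_cst.
  apply: measurable_funM => //; apply: measurable_sum => j.
  apply: measurable_funM => //; apply: measurable_funD; last exact: mxi.
  apply: (@measurableT_comp _ _ _ _ _ _ (h j)) (IH j).
  exact: continuous_measurable_fun (sqr_lipschitz_continuous cz0 (hlip j)).
by move=> omega _; exact: cvg_picard.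
Qed.

End Picard.

Section SquareIntegrable.
Context d (T : measurableType d) (R : realType).
Variable mu : {measure set T -> \bar R}.
Implicit Types f g : T -> R.

Lemma Lfun2_addr f g : f \in Lfun mu 2%:E -> g \in Lfun mu 2%:E ->
  (fun x => f x + g x) \in Lfun mu 2%:E.
Proof.
move=> /Lfun2P[mf f2] /Lfun2P[mg g2]; apply/Lfun2P; split.
  exact: measurable_funD.
apply: (integrable_le (g := fun x => 2 * f x ^+ 2 + 2 * g x ^+ 2)) => //.
- by apply: measurable_funX; exact: measurable_funD.
- by apply: integrable_addr => //; exact: integrable_mulrl.
- move=> x _; rewrite ger0_norm ?sqr_ge0//.
  by have := sqr_ge0 (f x - g x); rewrite sqrrB sqrrD; lra.
Qed.

Lemma Lfun2_mulrl f (k : R) : f \in Lfun mu 2%:E ->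
  (fun x => k * f x) \in Lfun mu 2%:E.
Proof.
move=> /Lfun2P[mf f2]; apply/Lfun2P; split; first exact: measurable_funM.
under [X in EFin \o X]funext do rewrite exprMn.
exact: integrable_mulrl.
Qed.

Lemma Lfun2_sumr (I : finType) (F : I -> T -> R) :
  (forall i, F i \in Lfun mu 2%:E) ->
  (fun x => \sum_i F i x) \in Lfun mu 2%:E.
Proof.
move=> h; elim: (index_enum I) => [|i s IH].
  under [X in X \in _]funext do rewrite big_nil.
  apply/Lfun2P; split => //; rewrite expr0n /=; exact: integrable0.
under [X in X \in _]funext do rewrite big_cons.
exact: Lfun2_addr.
Qed.

Lemma Lfun2_bounded f (c : R) : (mu setT < +oo)%E -> measurable_fun setT f ->
  (forall x, `|f x| <= c) -> f \in Lfun mu 2%:E.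
Proof.
move=> fin mf fc; apply/Lfun2P; split => //.
apply: (integrable_le (g := fun=> c ^+ 2)) => //; first exact: measurable_funX.
- have -> : EFin \o (fun=> c ^+ 2) = EFin \o cst (c ^+ 2) :> (T -> \bar R) by [].
  apply: measurable_bounded_integrable => //; exact: bounded_cst.
- move=> x _; rewrite ger0_norm ?sqr_ge0// -real_normK ?num_real//.
  by rewrite ler_pXn2r// nnegrE// (le_trans (normr_ge0 _) (fc x)).
Qed.

End SquareIntegrable.

Section IsState.
Context (R : realType) d (Omega : measurableType d) (P : probability Omega R).
Variables (N : nat) (W : 'M[R]_N) (b : R -> R -> R).
Variables (xi : 'I_N -> {mfun Omega >-> R}) (alpha : 'I_N -> R) (cz c0 : R).
Hypothesis cz0 : 0 <= cz.
Hypothesis hlip : forall j z z',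
  `|b (alpha j) z - b (alpha j) z'| ^+ 2 <= cz * `|z - z'| ^+ 2.
Hypothesis bbound : forall j z, `|b (alpha j) z| <= c0.
Hypothesis r1 : cz * ((N%:R ^+ 2)^-1 * \sum_(i < N) \sum_(j < N) W i j ^+ 2) < 1.
Hypothesis xi2 : forall j, (xi j : Omega -> R) \in Lfun P 2%:E.

Let h j := b (alpha j).
Let zf i omega := state W h (fun j => xi j omega) i.

Let mz i : measurable_fun setT (zf i).
Proof. by apply: (measurable_state cz0 hlip r1) => j; exact: measurable_funP. Qed.

(** The state is solved for each outcome separately, so the almost-sure
    uniqueness in L^2 is the uniqueness of a fixed point in R^N. *)
Lemma is_state_exists : exists z : 'I_N -> {mfun Omega >-> R},
  is_state P b W xi alpha z /\
  forall i omega, z i omega = N%:R^-1 *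
       \sum_(j < N) W i j * (b (alpha j) (z j omega) + xi j omega).
Proof.
pose z i : {mfun Omega >-> R} := mfun_Sub (mem_set (mz i)).
have zE i omega : z i omega = N%:R^-1 *
       \sum_(j < N) W i j * (b (alpha j) (z j omega) + xi j omega).
  exact: (stateE cz0 hlip r1).
exists z; split => //; split; first split.
- move=> i.
  have -> : (z i : Omega -> R) = (fun omega => N%:R^-1 *
       \sum_(j < N) W i j * (b (alpha j) (z j omega) + xi j omega)).
    by apply/funext => omega; exact: zE.
  apply/Lfun2_mulrl/Lfun2_sumr => j; apply/Lfun2_mulrl/Lfun2_addr => //.
  apply: (@Lfun2_bounded _ _ _ _ _ c0) => //.
    by rewrite [ltLHS]probability_setT ltry.
  apply: (@measurableT_comp _ _ _ _ _ _ (b (alpha j))) (measurable_funP (z j)).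
  exact: continuous_measurable_fun (sqr_lipschitz_continuous cz0 (hlip j)).
- by move=> i; apply: nearW => omega; exact: zE.
move=> z' [_ hz'] i.
have : \forall omega \ae P, forall i, z' i omega = N%:R^-1 *
       \sum_(j < N) W i j * (b (alpha j) (z' j omega) + xi j omega).
  exact: filter_forall.
apply: filterS => omega h'.
exact: (@state_map_fixed_unique _ _ W h _ hlip r1 (fun j => xi j omega)
  (fun j => z' j omega) (fun j => z j omega) h' (fun j => zE j omega)).
Qed.

End IsState.

(** * Laws, couplings and the noise *)

Section Laws.
Context d (T : measurableType d) (R : realType).
Implicit Types m : {measure set T -> \bar R}.

Lemma eq_measure_integrable m1 m2 (f : T -> \bar R) :
  (forall B, measurable B -> m1 B = m2 B) ->
  m1.-integrable setT f -> m2.-integrable setT f.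
Proof.
move=> m12 /integrableP[mf fi]; apply/integrableP; split => //.
by rewrite (eq_measure_integral m1) // => B mB _; rewrite m12.
Qed.

Lemma eq_measure_Rintegral m1 m2 (f : T -> R) :
  (forall B, measurable B -> m1 B = m2 B) ->
  \int[m1]_x f x = \int[m2]_x f x.
Proof. by move=> m12; congr fine; apply: eq_measure_integral => B mB _; exact: m12. Qed.

End Laws.

Section Coupling.
Context (R : realType) d (Omega : measurableType d) (P : probability Omega R).
Variables (mu0 : probability R R) (X : {mfun Omega >-> R}).
Hypothesis Xlaw : forall B : set R, measurable B -> distribution P X B = mu0 B.

Lemma joint_law_calK (Z : {mfun Omega >-> R}) : calK mu0 (joint_law P X Z).
Proof. by move=> B mB; rewrite -Xlaw. Qed.

Lemma joint_law_cst (v : R) (B : set (R * R)) : measurable B ->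
  joint_law P X (cst v) B = (mu0 \x \d_v)%E B.
Proof.
move=> mB; apply/esym; apply: product_measure_unique => // A1 A2 mA1 mA2.
transitivity (distribution P X A1 * \d_v A2)%E; last first.
  by congr (_ * _)%E; exact: Xlaw.
rewrite /joint_law /distribution /pushforward /= /dirac indicE.
have [v2|v2] := boolP (v \in A2).
  rewrite mule1; congr (P _); apply/seteqP; split => w /=; first by case.
  by split => //; exact: set_mem.
rewrite mule0; apply/eqP; rewrite -[X in _ == X](measure0 P); apply/eqP.
congr (P _); apply/seteqP; split => w //= -[_ vA].
by move/negP: v2; apply; exact: mem_set.
Qed.

Lemma Jt_law_cst (b : R -> R -> R) (f : R -> R -> R -> R) (a v : R) :
  Jt b f a (joint_law P X (cst v)) = Jc b f mu0 a v.
Proof. by apply: eq_measure_Rintegral => B mB; exact: joint_law_cst. Qed.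

Variables (b : R -> R -> R) (f : R -> R -> R -> R) (A : set R) (lt : R).
Hypothesis lt0 : 0 <= lt.
Hypothesis hJtLip : forall alpha nu nu', A alpha -> calK mu0 nu -> calK mu0 nu' ->
  (`|Jt b f alpha nu' - Jt b f alpha nu|%:E <= lt%:E * W2 nu nu')%E.

(** Coupling [(X, Z)] with [(X, Z')] through the same outcome. *)
Lemma W2_joint_law_le (Z Z' : {mfun Omega >-> R}) :
  P.-integrable setT (EFin \o (fun w => (Z w - Z' w) ^+ 2)) ->
  (W2 (joint_law P X Z) (joint_law P X Z') <=
   (Num.sqrt (\int[P]_w ((Z w - Z' w) ^+ 2)))%:E)%E.
Proof.
move=> ZZ.
pose g w := (joint X Z w, joint X Z' w).
have mg : measurable_fun setT g.
  by apply: measurable_fun_pair; exact: measurable_joint.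
pose G : {mfun Omega >-> ((R * R) * (R * R))%type} := mfun_Sub (mem_set mg).
pose pi : probability ((R * R) * (R * R))%type R := distribution P G.
have cpi : coupling (joint_law P X Z) (joint_law P X Z') pi by move=> B mB.
have msq : measurable_fun setT
    (fun p : (R * R) * (R * R) => (sqdist p.1 p.2)%:E).
  apply/measurable_EFinP; rewrite /sqdist.
  have m11 : measurable_fun setT (fun p : (R * R) * (R * R) => p.1.1).
    exact: measurableT_comp.
  have m12 : measurable_fun setT (fun p : (R * R) * (R * R) => p.1.2).
    exact: measurableT_comp.
  have m21 : measurable_fun setT (fun p : (R * R) * (R * R) => p.2.1).
    exact: measurableT_comp.
  have m22 : measurable_fun setT (fun p : (R * R) * (R * R) => p.2.2).
    exact: measurableT_comp.
  by apply: measurable_funD; apply: measurable_funX; exact: measurable_funB.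
have Epi : (\int[pi]_p (sqdist p.1 p.2)%:E = \int[P]_w ((Z w - Z' w) ^+ 2)%:E)%E.
  rewrite ge0_integral_distribution//; last first.
    by move=> p; rewrite lee_fin addr_ge0 ?sqr_ge0.
  by apply: eq_integral => w _; rewrite /= /sqdist /= subrr expr0n add0r.
have E0 : (0 <= \int[P]_w ((Z w - Z' w) ^+ 2)%:E)%E.
  by apply: integral_ge0 => w _; rewrite lee_fin sqr_ge0.
have EE : ((\int[P]_w ((Z w - Z' w) ^+ 2))%:E = \int[P]_w ((Z w - Z' w) ^+ 2)%:E)%E.
  by rewrite /Rintegral fineK//; exact: integrable_fin_num ZZ.
rewrite -powR12_sqrt; last by rewrite -lee_fin EE.
rewrite -poweR_EFin EE /W2 -Epi.
apply: gt0_ler_poweR.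
- by rewrite invr_ge0.
- rewrite in_itv /= leey andbT; apply: le_ereal_inf_tmp => _ [pi' _ <-].
  by apply: integral_ge0 => p _; rewrite lee_fin addr_ge0 ?sqr_ge0.
- by rewrite in_itv /= leey andbT Epi.
- by apply: ereal_inf_lbound; exists pi.
Qed.

Lemma Jt_joint_law_close (a : R) (Z Z' : {mfun Omega >-> R}) : A a ->
  P.-integrable setT (EFin \o (fun w => (Z w - Z' w) ^+ 2)) ->
  `|Jt b f a (joint_law P X Z') - Jt b f a (joint_law P X Z)| <=
  lt * Num.sqrt (\int[P]_w ((Z w - Z' w) ^+ 2)).
Proof.
move=> Aa ZZ; rewrite -lee_fin EFinM.
apply: le_trans (hJtLip Aa (joint_law_calK Z) (joint_law_calK Z')) _.
by apply: lee_wpmul2l; rewrite ?lee_fin//; exact: W2_joint_law_le.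
Qed.

End Coupling.

Section CostInState.
Context (R : realType).
Variables (mu0 : probability R R).
Variables (b : R -> R -> R) (f : R -> R -> R -> R) (A : set R) (lt : R).
Hypothesis lt0 : 0 <= lt.
Hypothesis hJtLip : forall alpha nu nu', A alpha -> calK mu0 nu -> calK mu0 nu' ->
  (`|Jt b f alpha nu' - Jt b f alpha nu|%:E <= lt%:E * W2 nu nu')%E.

(** The case of constant states, on the probability space of the noise itself. *)
Lemma Jc_lipschitz (a z z' : R) : A a ->
  `|Jc b f mu0 a z' - Jc b f mu0 a z| <= lt * `|z - z'|.
Proof.
move=> Aa.
have mid : measurable_fun setT (@idfun R) by exact: measurable_id.
pose X : {mfun R >-> R} := mfun_Sub (mem_set mid).
have Xlaw (B : set R) : measurable B -> distribution mu0 X B = mu0 B by [].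
rewrite -!(Jt_law_cst Xlaw).
have ZZ : mu0.-integrable setT
    (EFin \o (fun w => ((cst z : {mfun R >-> R}) w - (cst z' : {mfun R >-> R}) w) ^+ 2)).
  have -> : (EFin \o (fun w : R => ((cst z : {mfun R >-> R}) w - (cst z' : {mfun R >-> R}) w) ^+ 2)) =
    EFin \o cst ((z - z') ^+ 2) :> (R -> \bar R) by [].
  apply: measurable_bounded_integrable => //; last exact: bounded_cst.
  by rewrite [ltLHS]probability_setT ltry.
apply: (le_trans (Jt_joint_law_close Xlaw lt0 hJtLip Aa ZZ)) => /=.
rewrite Rintegral_cst// [X in fine X]probability_setT /= mulr1 sqrtr_sqr.
exact: lexx.
Qed.

End CostInState.

Section Noise.
Context (R : realType) d (Omega : measurableType d) (P : probability Omega R).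
Variables (mu0 : probability R R) (N : nat) (xi : 'I_N -> {mfun Omega >-> R}).
Hypothesis hmean : (\int[mu0]_x x%:E = 0)%E.
Hypothesis hvar : (\int[mu0]_x (x ^+ 2)%:E < +oo)%E.
Hypothesis hxi : iid P mu0 xi.

Let s2 := \int[mu0]_x (x ^+ 2).

Let mu02 : mu0.-integrable setT (EFin \o (fun x : R => x ^+ 2)).
Proof.
apply/integrableP; split.
  by apply/measurable_EFinP; exact: measurable_funX.
by under eq_integral => x _ do rewrite /= ger0_norm ?sqr_ge0//.
Qed.

Lemma noise_Lfun2 j : (xi j : Omega -> R) \in Lfun P 2%:E.
Proof.
apply/Lfun2P; split; first exact: measurable_funP.
apply/integrableP; split.
  by apply/measurable_EFinP/measurable_funX; exact: measurable_funP.
have := hvar; rewrite (eq_measure_integral (distribution P (xi j))); last first.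
  by move=> B mB _; have [h _] := hxi; apply/esym; exact: h.
rewrite ge0_integral_distribution//; last 2 first.
- by apply/measurable_EFinP; exact: measurable_funX.
- by move=> x; rewrite lee_fin sqr_ge0.
apply: le_lt_trans; rewrite le_eqVlt; apply/orP; left; apply/eqP.
by apply: eq_integral => w _; rewrite /= ger0_norm ?sqr_ge0.
Qed.

Lemma noise_mean_sqr j : \int[P]_w (xi j w ^+ 2) = s2.
Proof.
rewrite /s2 /Rintegral; congr fine.
rewrite [RHS](eq_measure_integral (distribution P (xi j))); last first.
  by move=> B mB _; have [h _] := hxi; apply/esym; exact: h.
rewrite ge0_integral_distribution//.
- by apply/measurable_EFinP; exact: measurable_funX.
- by move=> x; rewrite lee_fin sqr_ge0.
Qed.

(** The joint law of two distinct components is the product law. *)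
Lemma noise_uncorrelated j k : j != k -> \int[P]_w (xi j w * xi k w) = 0.
Proof.
move=> jk; have [law ind] := hxi.
have jl (B : set (R * R)) : measurable B ->
    (mu0 \x mu0)%E B = joint_law P (xi j) (xi k) B.
  move=> mB; apply: product_measure_unique => // A1 A2 mA1 mA2.
  pose B' i := if i == j then A1 else A2.
  have mB' i : measurable (B' i) by rewrite /B'; case: ifP.
  have := ind [set j; k]%SET B' mB'.
  rewrite big_setU1 ?inE//= big_set1 /B' eqxx eq_sym (negbTE jk).
  move=> indE; transitivity (distribution P (xi j) A1 * distribution P (xi k) A2)%E; last first.
    by congr (_ * _)%E; exact: law.
  apply: etrans indE.
  rewrite /joint_law /distribution /pushforward /=; congr (P _).
  apply/seteqP; split => w /=.
    move=> [h1 h2] i /=; rewrite !inE => /orP[/eqP ->|/eqP ->].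
      by rewrite eqxx.
    by rewrite eq_sym (negbTE jk).
  move=> h; split.
    by have := h j; rewrite /= !inE eqxx => /(_ isT).
  by have := h k; rewrite /= !inE eqxx orbT eq_sym (negbTE jk) => /(_ isT).
have [mj j2] := (Lfun2P _ _).1 (noise_Lfun2 j).
have [mk k2] := (Lfun2P _ _).1 (noise_Lfun2 k).
have jki := integrable_mul_sqr mj mk j2 k2.
have mm : measurable_fun setT (fun p : R * R => p.1 * p.2).
  by apply: measurable_funM; [exact: measurable_fst|exact: measurable_snd].
have li : (joint_law P (xi j) (xi k)).-integrable setT
    (EFin \o (fun p : R * R => p.1 * p.2)).
  by apply: integrable_pushforward => //; exact/measurable_EFinP.
have pri : (mu0 \x mu0)%E.-integrable setT (EFin \o (fun p : R * R => p.1 * p.2)).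
  by apply: eq_measure_integrable li => B mB; apply/esym; exact: jl.
have -> : \int[P]_w (xi j w * xi k w) =
    \int[joint_law P (xi j) (xi k)]_p (p.1 * p.2).
  rewrite /Rintegral; congr fine; rewrite integral_distribution//.
  exact/measurable_EFinP.
rewrite -(eq_measure_Rintegral _ jl) -(Rfubini1 pri) /=.
have mu01 : mu0.-integrable setT (EFin \o (fun x : R => x)).
  apply: integrable_of_sqr => //.
  by rewrite [ltLHS]probability_setT ltry.
under eq_Rintegral => x _.
  rewrite RintegralZl//.
  rewrite [X in x * X](_ : _ = 0); last by rewrite /Rintegral hmean.
  rewrite mulr0; over.
by rewrite Rintegral_cst// mul0r.
Qed.

Lemma noise_sum_sqr (a : 'I_N -> R) :
  P.-integrable setT (EFin \o (fun w => (\sum_j a j * xi j w) ^+ 2)) /\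
  \int[P]_w ((\sum_j a j * xi j w) ^+ 2) = s2 * \sum_j a j ^+ 2.
Proof.
have jk2 j k : P.-integrable setT (EFin \o (fun w => xi j w * xi k w)).
  have [mj j2] := (Lfun2P _ _).1 (noise_Lfun2 j).
  have [mk k2] := (Lfun2P _ _).1 (noise_Lfun2 k).
  exact: integrable_mul_sqr.
have jk3 j k : P.-integrable setT (EFin \o (fun w => a j * a k * (xi j w * xi k w))).
  by apply: integrable_mulrl.
have e w : (\sum_j a j * xi j w) ^+ 2 =
    \sum_j \sum_k a j * a k * (xi j w * xi k w).
  rewrite expr2 big_distrlr /=; apply: eq_bigr => j _; apply: eq_bigr => k _.
  by rewrite mulrACA.
split.
  under [X in EFin \o X]funext do rewrite e.
  by apply: integrable_sumr => // j _; exact: integrable_sumr.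
under eq_Rintegral do rewrite e.
rewrite Rintegral_sum//; last by move=> j _; exact: integrable_sumr.
rewrite mulr_sumr; apply: eq_bigr => j _; rewrite Rintegral_sum//.
rewrite (bigD1 j)//= big1 ?addr0.
  rewrite RintegralZl//; under eq_Rintegral do rewrite -expr2.
  by rewrite noise_mean_sqr -expr2 mulrC.
by move=> k kj; rewrite RintegralZl// noise_uncorrelated ?mulr0// eq_sym.
Qed.

End Noise.

(** * Deviation of the finite-player state from the graphon state *)

Lemma sqr_le_add3 (R : realType) (x u t y : R) : 0 <= x -> x <= u + (t + y) ->
  x ^+ 2 <= 2 * u ^+ 2 + (4 * t ^+ 2 + 4 * y ^+ 2).
Proof.
move=> x0 xu; apply: (@le_trans _ _ ((u + (t + y)) ^+ 2)).
  by rewrite ler_pXn2r// nnegrE (le_trans x0).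
rewrite -subr_ge0.
have -> : 2 * u ^+ 2 + (4 * t ^+ 2 + 4 * y ^+ 2) - (u + (t + y)) ^+ 2 =
    (u - (t + y)) ^+ 2 + 2 * (t - y) ^+ 2 by ring.
by rewrite addr_ge0 ?sqr_ge0// mulr_ge0 ?sqr_ge0.
Qed.

Section WeightedAverage.
Context (R : realType) (N : nat).
Hypothesis N0 : (0 < N)%N.
Let NR0 : (0 : R) < N%:R. Proof. by rewrite ltr0n. Qed.

(** Uniform integrability of one row of weights: indices with [m k] above the
    threshold [sqrt q] are few by Markov, hence carry little weight. *)
Lemma row_average_small (a m : 'I_N -> R) (K M q e zeta : R) :
  (forall k, 0 <= a k) -> (forall k, 0 <= m k) -> (forall k, m k <= M) ->
  0 < q -> 0 <= zeta -> 0 <= M ->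
  N%:R^-1 * \sum_k a k <= K ->
  (forall T : {set 'I_N}, N%:R^-1 * \sum_(k in T) a k <=
     e + zeta * Num.sqrt (#|T|%:R / N%:R)) ->
  \sum_k m k <= N%:R * q ->
  N%:R^-1 * \sum_k a k * m k <=
    K * Num.sqrt q + M * (e + zeta * Num.sqrt (Num.sqrt q)).
Proof.
move=> a0 m0 mM q0 z0 M0 aK aT mq.
pose t := Num.sqrt q; have t0 : 0 < t by rewrite sqrtr_gt0.
pose T := [set k | t < m k]%SET.
have cT : #|T|%:R / N%:R <= t.
  rewrite ler_pdivrMr// -(ler_pM2r t0) -[leRHS]mulrA [N%:R * t]mulrC mulrA.
  rewrite -[t * t]expr2 sqr_sqrtr; last exact: ltW.
  rewrite [leRHS]mulrC.
  apply: le_trans mq.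
  apply: (@le_trans _ _ (\sum_(k in T) m k)).
    rewrite -sum1_card natr_sum mulr_suml; apply: ler_sum => k.
    by rewrite inE mul1r => /ltW.
  by rewrite [leLHS]big_mkcond; apply: ler_sum => k _; case: ifP.
have sT : N%:R^-1 * \sum_(k in T) a k <= e + zeta * Num.sqrt t.
  apply: (le_trans (aT T)); rewrite lerD2l; apply: ler_wpM2l => //.
  by apply: ler_wsqrtr.
apply: (@le_trans _ _ (N%:R^-1 * \sum_k a k * t + M * (N%:R^-1 * \sum_(k in T) a k))).
  rewrite mulrCA -mulrDr; apply: ler_wpM2l; first by rewrite invr_ge0 ltW.
  rewrite mulr_sumr [X in _ + X]big_mkcond -big_split /=; apply: ler_sum => k _.
  case: ifPn => kT.
    rewrite mulrC [a k * t]mulrC -mulrDl ler_wpM2r//.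
    by rewrite (le_trans (mM k))// lerDr ltW.
  by rewrite addr0 ler_wpM2l//; move: kT; rewrite inE -leNgt.
apply: lerD; last exact: ler_wpM2l.
by rewrite -mulr_suml mulrA ler_wpM2r// ltW.
Qed.

End WeightedAverage.

Section Deviation.
Context (R : realType) d (Omega : measurableType d) (P : probability Omega R).
Variables (N : nat) (W : 'M[R]_N) (h : 'I_N -> R -> R) (B v : 'I_N -> R).
Variables (xi z : 'I_N -> {mfun Omega >-> R}) (i0 : 'I_N).
Variables (cz c0 tau K delta e zeta rho s q : R).
Hypothesis N0 : (0 < N)%N.
Hypothesis cz0 : 0 <= cz.
Hypothesis c00 : 0 <= c0.
Hypothesis tau0 : 0 <= tau.
Hypothesis zeta0 : 0 <= zeta.
Hypothesis hlip : forall j x y, `|h j x - h j y| ^+ 2 <= cz * `|x - y| ^+ 2.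
Hypothesis hbound : forall j x, `|h j x| <= c0.
Hypothesis Bbound : forall j, `|B j| <= c0.
Hypothesis hB : forall j, j != i0 -> `|h j (v j) - B j| <= tau.
Hypothesis vE : forall i, v i = N%:R^-1 * \sum_j W i j * B j.
Hypothesis zE : forall i w,
  z i w = N%:R^-1 * \sum_j W i j * (h j (z j w) + xi j w).
Hypothesis z2 : forall i, (z i : Omega -> R) \in Lfun P 2%:E.
Hypothesis WK : forall i, N%:R^-1 * \sum_j `|W i j| <= K.
Hypothesis Wdelta : forall i j, N%:R^-1 * `|W i j| <= delta.
Hypothesis WT : forall i (T : {set 'I_N}), N%:R^-1 * \sum_(j in T) `|W i j| <=
  e + zeta * Num.sqrt (#|T|%:R / N%:R).
Hypothesis Wrho :
  2 * cz * ((N%:R ^+ 2)^-1 * \sum_i \sum_j W i j ^+ 2) <= rho.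
Hypothesis rho1 : rho < 1.

Let n i w := N%:R^-1 * \sum_j W i j * xi j w.
Hypothesis ni : forall i, P.-integrable setT (EFin \o (fun w => n i w ^+ 2)).
Hypothesis ns : forall i, \int[P]_w (n i w ^+ 2) <= s.

Let theta := K * tau + 2 * c0 * delta.
Hypothesis q0 : 0 < q.
Hypothesis qge : 4 * (theta ^+ 2 + s) <= (1 - rho) * q.

Let D i w := z i w - v i.
Let avgD i w := N%:R^-1 * \sum_j `|W i j| * `|D j w|.

Let Ni0 : 0 <= N%:R^-1 :> R. Proof. by rewrite invr_ge0. Qed.

Let K0 : 0 <= K.
Proof. by apply: le_trans (WK i0); rewrite mulr_ge0// sumr_ge0. Qed.

Let delta0 : 0 <= delta.
Proof. by apply: le_trans (Wdelta i0 i0); rewrite mulr_ge0. Qed.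

Let s0 : 0 <= s.
Proof. by apply: le_trans (ns i0); apply: Rintegral_ge0 => w _; exact: sqr_ge0. Qed.

Let Dn i w : D i w = N%:R^-1 * \sum_j W i j * (h j (z j w) - B j) + n i w.
Proof.
rewrite /D zE vE /n -mulrBr -mulrDr -sumrB -big_split /=; congr (_ * _).
apply: eq_bigr => j _; ring.
Qed.

Let D_le i w (x : 'I_N -> R) : (forall j, `|h j (z j w) - B j| <= x j) ->
  `|D i w| <= N%:R^-1 * \sum_j `|W i j| * x j + `|n i w|.
Proof.
move=> hx; rewrite Dn (le_trans (ler_normD _ _))// lerD2r normrM (ger0_norm Ni0).
apply: ler_wpM2l => //; apply: (le_trans (ler_norm_sum _ _ _)); apply: ler_sum => j _.
by rewrite normrM ler_wpM2l.
Qed.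

(** Replacing the state of player [j] by [v j] costs the Lipschitz constant,
    and the mismatch left is [tau], except for the deviating player, where only
    the boundedness of [h] is available. *)
Let D_le1 i w : `|D i w| <= Num.sqrt cz * avgD i w + (theta + `|n i w|).
Proof.
have hx j : `|h j (z j w) - B j| <=
    Num.sqrt cz * `|D j w| + (tau + (j == i0)%:R * (2 * c0)).
  have -> : h j (z j w) - B j = (h j (z j w) - h j (v j)) + (h j (v j) - B j) by ring.
  apply: (le_trans (ler_normD _ _)); apply: lerD.
    exact: sqr_lipschitz_norm (hlip j) _ _.
  have [->|ji] := eqVneq j i0; last by rewrite mul0r addr0 hB.
  rewrite mul1r (le_trans (ler_normB _ _))//.
  by have := hbound i0 (v i0); have := Bbound i0; have := tau0; lra.
apply: (le_trans (D_le i hx)); rewrite addrA lerD2r.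
under eq_bigr do rewrite mulrDr mulrCA.
rewrite big_split /= -mulr_sumr mulrDr mulrCA lerD2l.
under eq_bigr do rewrite mulrDr.
rewrite big_split /= -mulr_suml mulrDr mulrA; apply: lerD; first exact: ler_wpM2r.
rewrite (bigD1 i0)//= eqxx mul1r big1 ?addr0; last first.
  by move=> j /negbTE ->; rewrite mul0r mulr0.
by rewrite mulrA [leRHS]mulrC ler_wpM2r// mulr_ge0.
Qed.

Let D_sqr i w : D i w ^+ 2 <= 2 * cz * avgD i w ^+ 2 + (4 * theta ^+ 2 + 4 * n i w ^+ 2).
Proof.
have := sqr_le_add3 (normr_ge0 _) (D_le1 i w).
rewrite !real_normK ?num_real// exprMn sqr_sqrtr// => h1.
by apply: (le_trans h1); rewrite mulrA.
Qed.

Let D2i i : P.-integrable setT (EFin \o (fun w => D i w ^+ 2)).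
Proof.
have /Lfun2P[] // : D i \in Lfun P 2%:E.
apply: (@Lfun2_addr _ _ _ _ (z i) (fun=> - v i)) => //.
apply: (@Lfun2_bounded _ _ _ _ _ `|v i|) => //; last by move=> _; rewrite normrN.
by rewrite [ltLHS]probability_setT ltry.
Qed.

Let m i := \int[P]_w (D i w ^+ 2).

Let m0 i : 0 <= m i.
Proof. by apply: Rintegral_ge0 => w _; exact: sqr_ge0. Qed.

Let Pcst (c : R) : P.-integrable setT (EFin \o (fun=> c)).
Proof.
have -> : EFin \o (fun=> c) = EFin \o cst c :> (Omega -> \bar R) by [].
apply: measurable_bounded_integrable => //; last exact: bounded_cst.
by rewrite [ltLHS]probability_setT ltry.
Qed.

Let E_cst (c : R) : \int[P]_w c = c.
Proof. by rewrite Rintegral_cst// [X in fine X]probability_setT mulr1. Qed.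

Let rest_int i : P.-integrable setT
  (EFin \o (fun w => 4 * theta ^+ 2 + 4 * n i w ^+ 2)).
Proof. by apply: integrable_addr => //; exact: integrable_mulrl. Qed.

Let rest_le i : \int[P]_w (4 * theta ^+ 2 + 4 * n i w ^+ 2) <= 4 * (theta ^+ 2 + s).
Proof.
rewrite RintegralD//; last exact: integrable_mulrl.
by rewrite E_cst RintegralZl// mulrDr lerD2l ler_wpM2l.
Qed.

Let sum_m : \sum_i m i <= N%:R * q.
Proof.
have pw w : (1 - rho) * \sum_i D i w ^+ 2 <=
    \sum_i (4 * theta ^+ 2 + 4 * n i w ^+ 2).
  have S0 : 0 <= \sum_i D i w ^+ 2 by apply: sumr_ge0 => i _; exact: sqr_ge0.
  have h1 : \sum_i avgD i w ^+ 2 <=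
      ((N%:R ^+ 2)^-1 * \sum_i \sum_j W i j ^+ 2) * \sum_i D i w ^+ 2.
    rewrite -mulrA mulr_suml mulr_sumr; apply: ler_sum => i _.
    rewrite exprMn -exprVn; apply: ler_wpM2l; first by rewrite exprn_ge0.
    apply: (le_trans (sum_cauchy_schwarz _ _)).
    under eq_bigr do rewrite real_normK ?num_real//.
    by under [X in _ * X]eq_bigr do rewrite real_normK ?num_real//.
  have h2 : \sum_i D i w ^+ 2 <= 2 * cz * \sum_i avgD i w ^+ 2 +
      \sum_i (4 * theta ^+ 2 + 4 * n i w ^+ 2).
    rewrite mulr_sumr -big_split /=; apply: ler_sum => i _; exact: D_sqr.
  have h3 : 2 * cz * \sum_i avgD i w ^+ 2 <= rho * \sum_i D i w ^+ 2.
    apply: (@le_trans _ _ (2 * cz * (((N%:R ^+ 2)^-1 * \sum_i \sum_j W i j ^+ 2) *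
        \sum_i D i w ^+ 2))).
      by apply: ler_wpM2l => //; rewrite mulr_ge0.
    by rewrite mulrA ler_wpM2r.
  lra.
have hq : (1 - rho) * \sum_i m i <= N%:R * ((1 - rho) * q).
  rewrite -Rintegral_sum// -RintegralZl//; last exact: integrable_sumr.
  apply: (@le_trans _ _ (\int[P]_w (\sum_i (4 * theta ^+ 2 + 4 * n i w ^+ 2)))).
    apply: le_Rintegral => //.
    - by apply: integrable_mulrl => //; exact: integrable_sumr.
    - exact: integrable_sumr.
  rewrite Rintegral_sum//.
  apply: (@le_trans _ _ (\sum_(i < N) (1 - rho) * q)).
    by apply: ler_sum => i _; exact: (le_trans (rest_le i) qge).
  by rewrite sumr_const card_ord -[leLHS]mulr_natl.
by move: hq; rewrite mulrCA ler_pM2l// subr_gt0.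
Qed.

Let M := 2 * (2 * c0 * K) ^+ 2 + 2 * s.

Let m_le i : m i <= M.
Proof.
have cK0 : 0 <= 2 * c0 * K by rewrite !mulr_ge0.
have pw w : D i w ^+ 2 <= 2 * (2 * c0 * K) ^+ 2 + 2 * n i w ^+ 2.
  have hx j : `|h j (z j w) - B j| <= 2 * c0.
    by apply: (le_trans (ler_normB _ _)); have := hbound j (z j w);
      have := Bbound j; lra.
  have h1 : `|D i w| <= 2 * c0 * K + `|n i w|.
    apply: (le_trans (D_le i hx)); rewrite lerD2r -mulr_suml mulrA mulrC.
    by apply: ler_wpM2l => //; rewrite mulr_ge0.
  rewrite -[D i w ^+ 2]real_normK ?num_real// -[n i w ^+ 2]real_normK ?num_real//.
  have h2 : `|D i w| ^+ 2 <= (2 * c0 * K + `|n i w|) ^+ 2.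
    by rewrite ler_pXn2r// ?nnegrE ?addr_ge0.
  apply: (le_trans h2).
  by have := sqr_ge0 (2 * c0 * K - `|n i w|); rewrite sqrrB sqrrD; lra.
apply: (@le_trans _ _ (\int[P]_w (2 * (2 * c0 * K) ^+ 2 + 2 * n i w ^+ 2))).
  apply: le_Rintegral => //.
  by apply: integrable_addr => //; exact: integrable_mulrl.
rewrite RintegralD//; last exact: integrable_mulrl.
by rewrite E_cst RintegralZl// lerD2l ler_wpM2l.
Qed.

(** A strict contraction in the normalised Euclidean norm gives smallness of
    the average over the players; feeding this into the single equation
    of player [i], whose row of weights is uniformly integrable, gives it for each
    player. *)
Lemma deviation_bound i : \int[P]_w ((z i w - v i) ^+ 2) <=
  2 * cz * K * (K * Num.sqrt q +
    (2 * (2 * c0 * K) ^+ 2 + 2 * s) * (e + zeta * Num.sqrt (Num.sqrt q))) +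
  4 * (theta ^+ 2 + s).
Proof.
rewrite -/(m i) -/M.
have avg_int : P.-integrable setT (EFin \o (fun w => \sum_j `|W i j| * D j w ^+ 2)).
  by apply: integrable_sumr => // j _; exact: integrable_mulrl.
have avg_int2 : P.-integrable setT
    (EFin \o (fun w => N%:R^-1 * \sum_j `|W i j| * D j w ^+ 2)).
  exact: integrable_mulrl.
have pw w : D i w ^+ 2 <= 2 * cz * K * (N%:R^-1 * \sum_j `|W i j| * D j w ^+ 2)
    + (4 * theta ^+ 2 + 4 * n i w ^+ 2).
  apply: (le_trans (D_sqr i w)); rewrite lerD2r -[2 * cz * K * _]mulrA.
  apply: ler_wpM2l; first by rewrite mulr_ge0.
  have -> : avgD i w = \sum_j (N%:R^-1 * `|W i j|) * `|D j w|.
    by rewrite /avgD mulr_sumr; apply: eq_bigr => j _; rewrite mulrA.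
  apply: (le_trans (sum_weighted_jensen _ _)).
    by move=> j; rewrite mulr_ge0.
  have -> : \sum_j N%:R^-1 * `|W i j| * `|D j w| ^+ 2 =
      N%:R^-1 * \sum_j `|W i j| * D j w ^+ 2.
    rewrite mulr_sumr; apply: eq_bigr => j _.
    by rewrite real_normK ?num_real// -mulrA.
  apply: ler_wpM2r.
    by rewrite mulr_ge0// sumr_ge0// => j _; rewrite mulr_ge0 ?sqr_ge0.
  by rewrite -mulr_sumr.
apply: (@le_trans _ _ (\int[P]_w (2 * cz * K *
    (N%:R^-1 * \sum_j `|W i j| * D j w ^+ 2) + (4 * theta ^+ 2 + 4 * n i w ^+ 2)))).
  apply: le_Rintegral => //.
  by apply: integrable_addr => //; exact: integrable_mulrl.
rewrite RintegralD//; last exact: integrable_mulrl.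
apply: lerD => //.
rewrite RintegralZl//; apply: ler_wpM2l; first by rewrite !mulr_ge0.
rewrite RintegralZl// Rintegral_sum//; last by move=> j _; exact: integrable_mulrl.
under eq_bigr do rewrite RintegralZl//.
apply: row_average_small => //.
by rewrite /M addr_ge0// mulr_ge0// sqr_ge0.
Qed.

End Deviation.

(** * The integrand of the state equation and the contraction constant *)

Section Composition.
Context d (T : measurableType d) (R : realType).
Variables (A : set R) (b : R -> R -> R) (ca cz lo hi : R).
Hypothesis ca0 : 0 <= ca.
Hypothesis cz0 : 0 <= cz.
Hypothesis AE : forall a, A a <-> lo <= a <= hi.
Hypothesis hlip : forall a a' z z', A a -> A a' ->
  `|b a z - b a' z'| ^+ 2 <= ca * `|a - a'| ^+ 2 + cz * `|z - z'| ^+ 2.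

Lemma lipschitz_snd a z z' : A a ->
  `|b a z - b a z'| ^+ 2 <= cz * `|z - z'| ^+ 2.
Proof.
by move=> Aa; have := hlip z z' Aa Aa; rewrite subrr normr0 expr0n mulr0 add0r.
Qed.

Lemma lipschitz_fst a a' z : A a -> A a' ->
  `|b a z - b a' z| <= Num.sqrt ca * `|a - a'|.
Proof.
move=> Aa Aa'; rewrite -(@ler_pXn2r _ 2)// ?nnegrE ?mulr_ge0 ?sqrtr_ge0//.
rewrite exprMn sqr_sqrtr//.
by have := hlip z z Aa Aa'; rewrite subrr normr0 expr0n mulr0 addr0.
Qed.

Variables (a z : T -> R).
Hypothesis ma : measurable_fun setT a.
Hypothesis mz : measurable_fun setT z.
Hypothesis aA : forall y, A (a y).

Let p (n : nat) (x : R) : R := lo + (Num.truncn (n.+1%:R * (x - lo)))%:R / n.+1%:R.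

Let xlo y : 0 <= a y - lo.
Proof. by have /AE/andP[h _] := aA y; rewrite subr_ge0. Qed.

Let p_le n y : lo <= p n (a y) <= a y.
Proof.
rewrite /p lerDl divr_ge0//= -lerBrDl ler_pdivrMr// mulrC.
by rewrite truncn_le mulr_ge0.
Qed.

Let pA n y : A (p n (a y)).
Proof.
apply/AE; have /AE/andP[_ h] := aA y; have /andP[-> h2] := p_le n y.
exact: le_trans h2 h.
Qed.

Let p_close n y : `|a y - p n (a y)| <= n.+1%:R^-1.
Proof.
have /andP[_ h2] := p_le n y; rewrite ger0_norm ?subr_ge0//.
rewrite /p opprD addrA lerBlDr -[leRHS]/(n.+1%:R^-1 + _ / n.+1%:R).
rewrite -[X in X + _ / _]mul1r -mulrDl ler_pdivlMr// mulrC.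
rewrite [1 + _]addrC natr1; apply/ltW; exact: truncnS_gt.
Qed.

(** A Caratheodory function composed with measurable functions: discretise
    the first argument towards the left endpoint of the action interval, so
    that the approximations stay in the domain where [b] is Lipschitz. *)
Lemma measurable_lipschitz_comp : measurable_fun setT (fun y => b (a y) (z y)).
Proof.
apply: (@measurable_fun_cvg _ _ _ _ (fun n y => b (p n (a y)) (z y))) => [n|y _].
  pose E m := a @^-1` `[lo + m%:R / n.+1%:R, lo + m.+1%:R / n.+1%:R[%classic.
  have mE m : measurable (E m) by rewrite -[E m]setTI; exact: ma.
  have EP m y : E m y -> Num.truncn (n.+1%:R * (a y - lo)) = m.
    rewrite /E /= in_itv /= -lerBrDl -ltrBlDl ler_pdivrMr// ltr_pdivlMr//.
    by rewrite mulrC => h; apply: truncn_def.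
  have -> : [set: T] = \bigcup_m E m.
    apply/esym/seteqP; split => // y _; exists (Num.truncn (n.+1%:R * (a y - lo))) => //.
    rewrite /E /= in_itv /= -lerBrDl -ltrBlDl ler_pdivrMr// ltr_pdivlMr// mulrC.
    by apply: truncn_itv; rewrite mulr_ge0.
  apply/measurable_fun_bigcup => // m.
  have [Am|Am] := pselect (A (lo + m%:R / n.+1%:R)).
    apply: (@eq_measurable_fun _ _ _ _ _ (fun y => b (lo + m%:R / n.+1%:R) (z y))).
      by move=> y /set_mem/EP e; rewrite /p e.
    apply: measurable_funTS.
    apply: (@measurableT_comp _ _ _ _ _ _ (b (lo + m%:R / n.+1%:R))) => //.
    apply: continuous_measurable_fun.
    exact: (sqr_lipschitz_continuous cz0 (fun z z' => lipschitz_snd z z' Am)).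
  have -> : E m = set0.
    apply/seteqP; split => // y Ey; apply: Am.
    by have := pA n y; rewrite /p (EP _ _ Ey).
  exact: measurable_fun_set0.
apply/cvgrPdist_le => e e0.
have ec0 : 0 < e / (Num.sqrt ca + 1) by rewrite divr_gt0// ltr_wpDl// sqrtr_ge0.
near=> n.
apply: (le_trans (lipschitz_fst (z y) (aA y) (pA n y))).
apply: (@le_trans _ _ ((Num.sqrt ca + 1) * n.+1%:R^-1)).
  apply: ler_pM; rewrite ?sqrtr_ge0 ?lerDl//.
rewrite mulrC -ler_pdivlMr; last by rewrite ltr_wpDl// sqrtr_ge0.
near: n; apply: filterS (near_infty_natSinv_lt (PosNum ec0)).
by move=> n /= /ltW.
Unshelve. all: by end_near. Qed.

End Composition.

Section EventualContraction.
Context (R : realType).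
Variables (W : forall N : nat, 'M[R]_N) (w : R * R -> R) (cz : R).
Hypothesis cz0 : 0 <= cz.
Hypothesis hw : graphon w.
Hypothesis hw2 : ((Num.sqrt (2 * cz))%:E * normL2II w < 1)%E.
Hypothesis hw2cvg : normL2II (Psi (W N)) @[N --> \oo] --> normL2II w.

(** The factor 2 in [2 * cz] is what the inequality
    [(x + y) ^ 2 <= 2 x ^ 2 + 2 y ^ 2] costs in the mean-square estimate of the
    deviation; it leaves a strict contraction. *)
Lemma eventual_contraction : exists2 rho : R, rho < 1 &
  \forall N \near \oo,
    2 * cz * ((N%:R ^+ 2)^-1 * \sum_(i < N) \sum_(j < N) W N i j ^+ 2) <= rho.
Proof.
have [_ /Lfun2P[mw w2]] := hw.
pose L := fine (normL2II w).
have LE : normL2II w = L%:E by rewrite /L /normL2II L2normE.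
have L0 : 0 <= L by rewrite /L fine_ge0//; exact: Lnorm_ge0.
have cL : Num.sqrt (2 * cz) * L < 1 by move: hw2; rewrite LE -EFinM lte_fin.
set c := Num.sqrt (2 * cz) in cL.
have c0 : 0 <= c by exact: sqrtr_ge0.
(* Any [L'] above [L] with [c * L' < 1] would do; this one also works when
   [c] vanishes. *)
pose L' := L + (1 - c * L) / (2 * (c + 1)).
have LL' : L < L' by rewrite ltrDl divr_gt0// ?subr_gt0// mulr_gt0// ltr_wpDl.
have cL' : c * L' < 1.
  have e : 1 - c * L' = (1 - c * L) * ((c + 2) / (2 * (c + 1))).
    by rewrite /L'; field; rewrite gt_eqF// ltr_wpDl.
  rewrite -subr_gt0 e mulr_gt0 ?subr_gt0// divr_gt0 ?mulr_gt0// ltr_wpDl//.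
exists ((c * L') ^+ 2).
  rewrite expr_lt1// mulr_ge0//; exact: le_trans L0 (ltW LL').
have : \forall N \near \oo, (normL2II (Psi (W N)) < L'%:E)%E.
  apply: (hw2cvg (t := [set y | (y < L'%:E)%E])).
  apply: open_nbhs_nbhs; split; first exact: open_ereal_lt_ereal.
  by rewrite /= LE lte_fin.
apply: filterS2 (nbhs_infty_gt 0) => N N0.
rewrite normL2II_Psi// lte_fin; set X := _^-1 * _ => XL.
have X0 : 0 <= X.
  rewrite mulr_ge0 ?invr_ge0 ?exprn_ge0//.
  by apply: sumr_ge0 => i _; apply: sumr_ge0 => j _; exact: sqr_ge0.
rewrite exprMn sqr_sqrtr ?mulr_ge0//; apply: ler_wpM2l; first by rewrite mulr_ge0.
rewrite -[X in X <= _]sqr_sqrtr//; rewrite ler_pXn2r ?nnegrE ?sqrtr_ge0 ?(ltW XL)//.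
exact: le_trans (sqrtr_ge0 _) (ltW XL).
Qed.

End EventualContraction.

(** * Limits *)

Section Limits.
Context (R : realType).
Implicit Types u v : nat -> R.

Lemma cvg0_sqrt u : u @ \oo --> (0 : R) -> (fun n => Num.sqrt (u n)) @ \oo --> (0 : R).
Proof.
move=> u0; rewrite -[X in _ --> X]sqrtr0.
by apply: (cvg_comp _ _ u0); exact: sqrt_continuous.
Qed.

Lemma cvg0_mulr (l : R) u v : u @ \oo --> l -> v @ \oo --> (0 : R) ->
  (fun n => u n * v n) @ \oo --> (0 : R).
Proof. by move=> ul v0; rewrite -[X in _ --> X](mulr0 l); exact: cvgM. Qed.

Lemma cvg0_cstM (c : R) u : u @ \oo --> (0 : R) -> (fun n => c * u n) @ \oo --> (0 : R).
Proof. by apply: cvg0_mulr; exact: cvg_cst. Qed.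

Lemma cvg0_add u v : u @ \oo --> (0 : R) -> v @ \oo --> (0 : R) ->
  (fun n => u n + v n) @ \oo --> (0 : R).
Proof. by move=> u0 v0; rewrite -[X in _ --> X](addr0 0); exact: cvgD. Qed.

Lemma cvg_natV : (fun n => n%:R^-1 : R) @ \oo --> (0 : R).
Proof.
rewrite -(cvg_shiftS (fun n => n%:R^-1 : R)) /=.
exact: cvg_harmonic.
Qed.

End Limits.

(** * The approximate equilibrium *)

Section ErrorBound.
Context (R : realType).
Variables (ca cz lc lt c0 zeta rho s2 : R).

(** In these bounds [g] is the number of players times the cut distance and [u]
    the inverse of the number of players.  The summands [u] in [cell_error] and
    [average_error] make these positive: the square root of the former is a
    divisor in the estimate of the actions, that of the latter is the threshold
    in [row_average_small]. *)
Definition cell_error (g u : R) := 2 * lt * (4 * c0 * g) + u.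

(** Mismatch of [v] in the noiseless state equation of the finite game. *)
Definition drift_error (g u : R) :=
  Num.sqrt ca * ((4 / lc + 2^-1) * Num.sqrt (cell_error g u)) +
  Num.sqrt cz * (4 * c0 * g).

Definition row_bound (g : R) := 4 * g + zeta.

(** The row mass of a single entry: only [1 / N] of the players. *)
Definition entry_bound (g u : R) := 4 * g + zeta * Num.sqrt u.

Definition theta_error (g u : R) :=
  row_bound g * drift_error g u + 2 * c0 * entry_bound g u.

Definition noise_error (g u : R) := s2 * (entry_bound g u * row_bound g).

Definition average_error (g u : R) :=
  4 * (theta_error g u ^+ 2 + noise_error g u) / (1 - rho) + u.

Definition state_error (g u : R) :=
  2 * cz * row_bound g * (row_bound g * Num.sqrt (average_error g u) +
    (2 * (2 * c0 * row_bound g) ^+ 2 + 2 * noise_error g u) *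
    (4 * g + zeta * Num.sqrt (Num.sqrt (average_error g u)))) +
  4 * (theta_error g u ^+ 2 + noise_error g u).

Definition nash_error (g u : R) :=
  2 * lt * Num.sqrt (state_error g u) + cell_error g u.

Lemma cvg_nash_error (g u : nat -> R) :
  g @ \oo --> (0 : R) -> u @ \oo --> (0 : R) ->
  (fun n => nash_error (g n) (u n)) @ \oo --> (0 : R).
Proof.
move=> g0 u0.
have cst (c : R) : (fun _ : nat => c) @ \oo --> c by exact: cvg_cst.
have hcell : (fun n => cell_error (g n) (u n)) @ \oo --> (0 : R).
  by apply: cvg0_add => //; apply: cvg0_cstM; exact: cvg0_cstM.
have hdrift : (fun n => drift_error (g n) (u n)) @ \oo --> (0 : R).
  apply: cvg0_add; last by apply: cvg0_cstM; exact: cvg0_cstM.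
  by apply: cvg0_cstM; apply: cvg0_cstM; exact: cvg0_sqrt.
have hrow : (fun n => row_bound (g n)) @ \oo --> 0 + zeta.
  by apply: cvgD; [exact: cvg0_cstM|exact: cst].
have hentry : (fun n => entry_bound (g n) (u n)) @ \oo --> (0 : R).
  by apply: cvg0_add; apply: cvg0_cstM => //; exact: cvg0_sqrt.
have htheta : (fun n => theta_error (g n) (u n)) @ \oo --> (0 : R).
  by apply: cvg0_add; [exact: (cvg0_mulr hrow hdrift)|exact: cvg0_cstM].
have hnoise : (fun n => noise_error (g n) (u n)) @ \oo --> (0 : R).
  apply: cvg0_cstM; under eq_fun do rewrite mulrC.
  exact: (cvg0_mulr hrow hentry).
have hrest : (fun n => 4 * (theta_error (g n) (u n) ^+ 2 + noise_error (g n) (u n)))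
    @ \oo --> (0 : R).
  by apply: cvg0_cstM; apply: cvg0_add => //; exact: (cvg0_mulr htheta htheta).
have havg : (fun n => average_error (g n) (u n)) @ \oo --> (0 : R).
  apply: cvg0_add => //; under eq_fun do rewrite mulrC.
  exact: cvg0_cstM.
have hM : (fun n => 2 * (2 * c0 * row_bound (g n)) ^+ 2 + 2 * noise_error (g n) (u n))
    @ \oo --> 2 * ((2 * c0 * (0 + zeta)) * (2 * c0 * (0 + zeta)))
      + 2 * 0.
  apply: cvgD; last by apply: cvgM => //; exact: cst.
  by apply: cvgM; [exact: cst|apply: cvgM; apply: cvgM => //; exact: cst].
apply: cvg0_add => //; apply: cvg0_cstM; apply: cvg0_sqrt; apply: cvg0_add => //.
apply: (@cvg0_mulr _ (2 * cz * (0 + zeta))).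
  by apply: cvgM => //; exact: cst.
apply: cvg0_add; first by apply: (cvg0_mulr hrow); exact: cvg0_sqrt.
apply: (cvg0_mulr hM); apply: cvg0_add; first exact: cvg0_cstM.
by apply: cvg0_cstM; apply: cvg0_sqrt; exact: cvg0_sqrt.
Qed.

End ErrorBound.

Section FixedSize.
Context (R : realType).
Notation mu := (@lebesgue_measure R).
Variables (A : set R) (mu0 : probability R R).
Variables (b : R -> R -> R) (f : R -> R -> R -> R).
Variables (ca cz lc lt c0 : R).
Hypothesis hA0 : A !=set0.
Hypothesis hAclosed : closed A.
Hypothesis hAconvex : convex_set (A : set (convex_lmodType R^o)).
Hypothesis hAbounded : bounded_set A.
Hypothesis hmean : (\int[mu0]_x x%:E = 0)%E.
Hypothesis hca : 0 <= ca.
Hypothesis hcz : 0 <= cz.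
Hypothesis hlc : 0 < lc.
Hypothesis hlt : 0 <= lt.
Hypothesis hc0 : 0 < c0.
Hypothesis hbLip : forall alpha alpha' z z', A alpha -> A alpha' ->
     `|b alpha z - b alpha' z'| ^+ 2 <=
       ca * `|alpha - alpha'| ^+ 2 + cz * `|z - z'| ^+ 2.
Hypothesis hvar : (\int[mu0]_x (x ^+ 2)%:E < +oo)%E.
Hypothesis hJtLip : forall alpha nu nu', A alpha -> calK mu0 nu -> calK mu0 nu' ->
     (`|Jt b f alpha nu' - Jt b f alpha nu|%:E <= lt%:E * W2 nu nu')%E.
Variable dJ : R -> R -> R.
Hypothesis hJC1 : forall z, C1_on A (Jc b f mu0 ^~ z) (dJ ^~ z).
Hypothesis hJconvex : forall (alpha alpha' z eps : R), A alpha -> A alpha' ->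
     0 <= eps <= 1 ->
     Jc b f mu0 (eps * alpha + (1 - eps) * alpha') z <=
       eps * Jc b f mu0 alpha z + (1 - eps) * Jc b f mu0 alpha' z
       - lc / 2 * eps * (1 - eps) * `|alpha - alpha'| ^+ 2.
Hypothesis hbbound : forall alpha z, A alpha -> `|b alpha z| <= c0.
Variables (w : R * R -> R) (zeta : R).
Hypothesis hw : graphon w.
Hypothesis hwrow : (ereal_sup [set normL2I (fun y => w (x, y)) | x in @I01 R]
              <= zeta%:E)%E.
Variable alphahat : R -> R.
Hypothesis hnash : graphon_nash A b f mu0 w alphahat.

Let mI01 : measurable (@I01 R).
Proof. by rewrite /I01; exact: measurable_itv. Qed.

Let muI01 : (mu (@I01 R) < +oo)%E.
Proof.
by rewrite /I01 lebesgue_measure_itv /= lte_fin ltr01 oppr0 adde0 ltry.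
Qed.

Lemma L2I_measurable_integrable (h : R -> R) : L2I h ->
  measurable_fun setT (h \_ @I01 R) /\ mu.-integrable (@I01 R) (EFin \o h).
Proof.
move=> /Lfun2P[mh h2]; split => //.
apply: integrable_of_sqr => //.
  by apply/measurable_restrictT.
apply/integrable_restrictP => //.
apply: eq_integrable h2 => // z _ /=.
by rewrite !patchE; case: ifP => //; rewrite expr0n.
Qed.

(** The integrand of the graphon state, corrected on a null set into a bounded
    measurable function: actions are clamped to the action interval. *)
Lemma graphon_state_rep : exists (z bh : R -> R),
  [/\ measurable_fun setT bh, forall y, `|bh y| <= c0,
      mu.-integrable (@I01 R) (EFin \o z),
      mu.-integrable (@I01 R) (EFin \o alphahat) &
   [/\ \forall y \ae mu, I01 y -> bh y = b (alphahat y) (z y),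
      \forall x \ae mu, I01 x -> z x = \int[mu]_y (graphon_ext w (x, y) * bh y),
      \forall y \ae mu, I01 y -> A (alphahat y) &
      \forall x \ae mu, I01 x -> forall a, A a ->
         Jc b f mu0 (alphahat x) (z x) <= Jc b f mu0 a (z x)]].
Proof.
have [[aL aA] [z [[[zL zeq] _] zopt]]] := hnash.
have [ma ia] := L2I_measurable_integrable aL.
have [mz iz] := L2I_measurable_integrable zL.
have [lo [hi AE]] := action_set_itv hA0 hAclosed hAconvex hAbounded.
have lohi : lo <= hi by case: hA0 => a /AE/andP[]; exact: le_trans.
pose ac y := Num.max lo (Num.min hi ((alphahat \_ @I01 R) y)).
have acA y : A (ac y).
  by apply/AE; rewrite /ac le_max lexx /= ge_max lohi ge_min lexx.
have mac : measurable_fun setT ac.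
  by apply: measurable_maxr => //; apply: measurable_minr.
pose bh y := b (ac y) ((z \_ @I01 R) y).
have bhE : \forall y \ae mu, I01 y -> bh y = b (alphahat y) (z y).
  apply: (aeS aA) => y hy Iy; have /AE/andP[h1 h2] := hy Iy.
  rewrite /bh /ac !patchE mem_set//; congr b.
  by rewrite min_r// max_r.
exists z, bh; split => //.
- exact: (measurable_lipschitz_comp hca hcz AE hbLip).
- by move=> y; exact: hbbound.
split => //; apply: (aeS zeq) => x h Ix; rewrite (h Ix) -(graphon_op_ext w bh Ix).
apply: ae_eq_Rintegral; apply: (aeS bhE) => y hy Iy.
by rewrite hy.
Qed.

Variables (d : measure_display) (Omega : measurableType d).
Variables (P : probability Omega R) (N : nat) (W : 'M[R]_N).
Variables (xi : 'I_N -> {mfun Omega >-> R}) (gamma rho : R).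
Hypothesis N0 : (0 < N)%N.
Hypothesis hcut : (cutnorm (fun p => Psi W p - w p)%R <= gamma%:E)%E.
Hypothesis hxi : iid P mu0 xi.
Hypothesis Wrho :
  2 * cz * ((N%:R ^+ 2)^-1 * \sum_(i < N) \sum_(j < N) W i j ^+ 2) <= rho.
Hypothesis rho1 : rho < 1.

Let NR0 : (0 : R) < N%:R. Proof. by rewrite ltr0n. Qed.

Let g := N%:R * gamma.
Let u : R := N%:R^-1.
Let s2 := \int[mu0]_x (x ^+ 2).

Let g0 : 0 <= g. Proof. by rewrite mulr_ge0// (gamma_ge0 hw N0 hcut). Qed.

Let u0 : 0 < u. Proof. by rewrite invr_gt0. Qed.

Let eta := cell_error lt c0 g u.

Let eta0 : 0 < eta.
Proof.
rewrite /eta /cell_error; apply: ltr_wpDl => //.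
by do 2 apply: mulr_ge0 => //; apply: mulr_ge0 => //; exact: ltW.
Qed.

Let K := row_bound zeta g.
Let delta := entry_bound zeta g u.
Let tau := drift_error ca cz lc lt c0 g u.

Let z0 : 0 <= zeta. Proof. exact: zeta_ge0 hwrow. Qed.

Let WT i (T : {set 'I_N}) : N%:R^-1 * \sum_(j in T) `|W i j| <=
  4 * g + zeta * Num.sqrt (#|T|%:R / N%:R).
Proof. exact: (row_mass hw hwrow N0 hcut). Qed.

Let WK i : N%:R^-1 * \sum_j `|W i j| <= K.
Proof.
have := WT i [set: 'I_N]%SET; rewrite finset.cardsT card_ord divff ?gt_eqF// sqrtr1 mulr1 => h.
by apply: le_trans h; rewrite le_eqVlt; apply/orP; left; apply/eqP; congr (_ * _);
  apply: eq_bigl => j; rewrite inE.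
Qed.

Let Wdelta i j : N%:R^-1 * `|W i j| <= delta.
Proof. by have := WT i [set j]%SET; rewrite big_set1 cards1 mul1r. Qed.

Let K0 : 0 <= K.
Proof. by apply: addr_ge0 => //; exact: mulr_ge0. Qed.

Let delta0 : 0 <= delta.
Proof. by apply: addr_ge0; apply: mulr_ge0 => //; exact: sqrtr_ge0. Qed.

Let s20 : 0 <= s2.
Proof. by apply: Rintegral_ge0 => x _; exact: sqr_ge0. Qed.

Let noise_small i :
  P.-integrable setT (EFin \o (fun w => (N%:R^-1 * \sum_j W i j * xi j w) ^+ 2)) /\
  \int[P]_w ((N%:R^-1 * \sum_j W i j * xi j w) ^+ 2) <= noise_error zeta s2 g u.
Proof.
have [h1 h2] := noise_sum_sqr hmean hvar hxi (fun j => N%:R^-1 * W i j).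
have e w' : N%:R^-1 * \sum_j W i j * xi j w' = \sum_j N%:R^-1 * W i j * xi j w'.
  by rewrite mulr_sumr; apply: eq_bigr => j _; rewrite mulrA.
split.
  by apply: eq_integrable h1 => // w' _ /=; rewrite e.
under eq_Rintegral do rewrite e.
rewrite h2; apply: ler_wpM2l => //.
apply: (@le_trans _ _ (delta * (N%:R^-1 * \sum_j `|W i j|))); last exact: ler_wpM2l.
rewrite !mulr_sumr; apply: ler_sum => j _.
rewrite exprMn -[W i j ^+ 2]real_normK ?num_real// -exprMn expr2.
by apply: ler_wpM2r; rewrite ?mulr_ge0.
Qed.

(** Both profiles of the equilibrium inequality differ from the averaged one for
    at most one player, so the same estimate [main] compares the cost of this
    player with the cost in the deterministic state [v]. *)
Lemma fixed_size_eps_nash :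
  eps_nash P A b f W xi (nash_error ca cz lc lt c0 zeta rho s2 g u) (muN alphahat).
Proof.
have [z [bh [mbh bhc iz ia [bhE zE aA zopt]]]] := graphon_state_rep.
pose v := avg_op W bh.
pose B j := N%:R * \int[mu]_(y in cell N j) bh y.
have vE i : v i = N%:R^-1 * \sum_j W i j * B j.
  rewrite /v /avg_op mulr_sumr; apply: eq_bigr => j _.
  by rewrite /B (mulrCA (W i j)) mulKf ?gt_eqF//.
have icell (h : R -> R) (i : 'I_N) : mu.-integrable (@I01 R) (EFin \o h) ->
    mu.-integrable (cell N i) (EFin \o h).
  move=> hi; apply: (integrableS _ _ _ hi) => //; first exact: measurable_cell.
  exact: sub_cell_I01.
have mucell (i : 'I_N) : mu (cell N i) = ((N%:R : R)^-1)%:E by exact: lebesgue_cell.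
have ibh (i : 'I_N) : mu.-integrable (cell N i) (EFin \o bh).
  exact: (integrable_bounded_cell N0 mbh bhc).
pose r i x := `|v i - z x|.
have ir (i : 'I_N) : mu.-integrable (cell N i) (EFin \o r i).
  apply: integrable_normr; first exact: measurable_cell.
  apply: integrable_subr; first exact: measurable_cell.
    exact: integrable_cst_cell.
  exact: icell.
have ravg (i : 'I_N) : N%:R * \int[mu]_(x in cell N i) r i x <= 4 * c0 * g.
  have := avg_op_close hw hwrow N0 hcut mbh (ltW hc0) bhc i.
  rewrite (_ : \int[mu]_(x in cell N i) _ = \int[mu]_(x in cell N i) r i x)//.
  apply: ae_eq_Rintegral; apply: (aeS zE) => x h ix.
  by rewrite /r (h (sub_cell_I01 N0 ix)).
pose al := muN alphahat : 'I_N -> R.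
have alE (i : 'I_N) : al i = N%:R * \int[mu]_(x in cell N i) alphahat x.
  exact: muNE.
pose J x := Jc b f mu0 ^~ x.
have Jl a x y : A a -> `|J x a - J y a| <= lt * `|x - y|.
  by move=> Aa; have := Jc_lipschitz hlt hJtLip y x Aa; rewrite [`|y - x|]distrC.
have aAc (i : 'I_N) : \forall x \ae mu, cell N i x -> A (alphahat x).
  by apply: (aeS aA) => x h ix; apply: h; exact: sub_cell_I01 ix.
have aopt (i : 'I_N) : \forall x \ae mu, cell N i x ->
    forall a, A a -> J (v i) (alphahat x) <= J (v i) a + 2 * lt * r i x.
  apply: (aeS2 aA zopt) => x h1 h2 ix a Aa.
  have Ix := sub_cell_I01 N0 ix.
  have Ax := h1 Ix; have hzx := h2 Ix _ Aa.
  have q1 : J (v i) (alphahat x) <= J (z x) (alphahat x) + lt * r i x.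
    by rewrite -lerBlDl; apply: le_trans (ler_norm _) _; exact: Jl.
  have q2 : J (z x) a <= J (v i) a + lt * r i x.
    rewrite -lerBlDl /r distrC; apply: le_trans (ler_norm _) _; exact: Jl.
  apply: (le_trans q1); rewrite -[2 * lt * _]mulrA mulr2n mulrDl mul1r addrA lerD2r.
  exact: le_trans hzx q2.
have ir2 (i : 'I_N) : mu.-integrable (cell N i) (EFin \o (fun x => 2 * lt * r i x)).
  by apply: integrable_mulrl => //; exact: measurable_cell.
have ravg2 (i : 'I_N) : N%:R * \int[mu]_(x in cell N i) (2 * lt * r i x) <= eta.
  rewrite RintegralZl//; last exact: measurable_cell.
  rewrite mulrCA /eta /cell_error.
  have : 2 * lt * (N%:R * \int[mu]_(x in cell N i) r i x) <= 2 * lt * (4 * c0 * g).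
    by apply: ler_wpM2l => //; rewrite mulr_ge0.
  by move: u0; lra.
have alA (i : 'I_N) : A (al i).
  rewrite alE.
  exact: (avg_action_mem (mu := mu) (measurable_cell N i) NR0 (mucell i)
    hA0 hAclosed hAconvex hAbounded (icell _ i ia) (aAc i)).
have Jcv (i : 'I_N) (a1 a2 e : R) : A a1 -> A a2 -> 0 <= e <= 1 ->
    J (v i) (e * a1 + (1 - e) * a2) <= e * J (v i) a1 + (1 - e) * J (v i) a2
     - lc / 2 * e * (1 - e) * `|a1 - a2| ^+ 2.
  by move=> A1 A2 e01; exact: hJconvex.
have Jopt (i : 'I_N) a : A a -> J (v i) (al i) <= J (v i) a + eta.
  move=> Aa; rewrite alE.
  exact: (avg_action_opt (mu := mu) (measurable_cell N i) NR0 (mucell i)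
    hA0 hAclosed hAconvex hAbounded hlc (Jcv i) (hJC1 (v i))
    (icell _ i ia) (ir2 i) (aAc i) (aopt i) (ravg2 i) Aa).
have anear (i : 'I_N) : \forall x \ae mu, cell N i x -> `|al i - alphahat x| <=
    (2 / lc + 2^-1) * Num.sqrt eta + 2 / lc / Num.sqrt eta * (2 * lt * r i x).
  rewrite alE.
  exact: (avg_action_near (mu := mu) (measurable_cell N i) NR0 (mucell i)
    hA0 hAclosed hAconvex hAbounded hlc (Jcv i) (hJC1 (v i))
    (icell _ i ia) (ir2 i) (aAc i) (aopt i) (ravg2 i) eta0).
have hB (i : 'I_N) : `|b (al i) (v i) - B i| <= tau.
  pose k := Num.sqrt ca * (2 / lc / Num.sqrt eta * (2 * lt)) + Num.sqrt cz.
  pose e := Num.sqrt ca * ((2 / lc + 2^-1) * Num.sqrt eta).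
  (* Compare both terms with [b (alphahat x) (v i)]. *)
  have near : \forall x \ae mu, cell N i x ->
      `|b (al i) (v i) - bh x| <= e + k * r i x.
    have h1 := anear i; have h2 := aAc i.
    apply: (aeS2 (aeS2 h1 h2 (fun x p q => conj p q)) bhE) => x [{}h1 {}h2] h3 ix.
    rewrite (h3 (sub_cell_I01 N0 ix)).
    have Ax := h2 ix.
    have -> : b (al i) (v i) - b (alphahat x) (z x) =
      (b (al i) (v i) - b (alphahat x) (v i)) +
      (b (alphahat x) (v i) - b (alphahat x) (z x)) by ring.
    apply: (le_trans (ler_normD _ _)).
    have p1 := lipschitz_fst hca hbLip (v i) (alA i) Ax.
    have p2 := sqr_lipschitz_norm hcz (fun x1 x2 => lipschitz_snd hbLip x1 x2 Ax) (v i) (z x).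
    have p3 := ler_wpM2l (sqrtr_ge0 ca) (h1 ix).
    apply: (le_trans (lerD (le_trans p1 p3) p2)).
    by rewrite /e /k -/(r i x) le_eqVlt; apply/orP; left; apply/eqP; ring.
  have := avg_distance (mu := mu) (measurable_cell N i) NR0 (mucell i) (ibh i) (ir i) near.
  move=> /le_trans; apply.
  have k0 : 0 <= k.
    by rewrite addr_ge0 ?sqrtr_ge0// !mulr_ge0 ?invr_ge0 ?sqrtr_ge0// ltW.
  apply: (@le_trans _ _ (e + k * (4 * c0 * g))); first by rewrite lerD2l ler_wpM2l.
  rewrite /tau /drift_error -/eta /k /e [(_ + Num.sqrt cz) * _]mulrDl addrA lerD2r.
  rewrite -[Num.sqrt ca * _ * _]mulrA -mulrDr; apply: ler_wpM2l; first exact: sqrtr_ge0.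
  have se : 0 < Num.sqrt eta by rewrite sqrtr_gt0.
  have : 2 / lc / Num.sqrt eta * (2 * lt) * (4 * c0 * g) <= 2 / lc * Num.sqrt eta.
    have -> : 2 / lc / Num.sqrt eta * (2 * lt) * (4 * c0 * g) =
       2 / lc * (2 * lt * (4 * c0 * g) / Num.sqrt eta) by ring.
    apply: ler_wpM2l; first by rewrite divr_ge0// ltW.
    rewrite ler_pdivrMr// -expr2 sqr_sqrtr ?(ltW eta0)// /eta /cell_error lerDl.
    exact: ltW.
  have -> : (4 / lc + 2^-1) * Num.sqrt eta =
    (2 / lc + 2^-1) * Num.sqrt eta + 2 / lc * Num.sqrt eta by field; rewrite gt_eqF.
  lra.
have Bc (j : 'I_N) : `|B j| <= c0.
  have near : \forall x \ae mu, cell N j x -> `|0 - bh x| <= c0 + 0 * r j x.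
    by apply: nearW => x _; rewrite sub0r normrN mul0r addr0.
  have := avg_distance (mu := mu) (measurable_cell N j) NR0 (mucell j) (ibh j) (ir j) near.
  by rewrite sub0r normrN mul0r addr0.
have xi2 (j : 'I_N) : (xi j : Omega -> R) \in Lfun P 2%:E.
  exact: (noise_Lfun2 hvar hxi).
set sn := noise_error zeta s2 g u.
set theta := theta_error ca cz lc lt c0 zeta g u.
set q := average_error ca cz lc lt c0 zeta rho s2 g u.
have sn0 : 0 <= sn by rewrite !mulr_ge0.
have rest0 : 0 <= 4 * (theta ^+ 2 + sn) by rewrite mulr_ge0 ?addr_ge0 ?sqr_ge0.
have r10 : 0 < 1 - rho by rewrite subr_gt0.
have q0 : 0 < q by rewrite ltr_wpDl// divr_ge0// ltW.
have qge : 4 * (theta ^+ 2 + sn) <= (1 - rho) * q.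
  rewrite /q /average_error -/theta -/sn; set X := 4 * _.
  rewrite mulrDr mulrCA divff ?gt_eqF// mulr1 lerDl.
  by apply: mulr_ge0; exact: ltW.
set mm := state_error ca cz lc lt c0 zeta rho s2 g u.
have tau0 : 0 <= tau by exact: le_trans (normr_ge0 _) (hB (Ordinal N0)).
have r1 : cz * ((N%:R ^+ 2)^-1 * \sum_(i < N) \sum_(j < N) W i j ^+ 2) < 1.
  apply: le_lt_trans rho1; apply: le_trans Wrho; apply: ler_wpM2r.
    rewrite mulr_ge0 ?invr_ge0 ?exprn_ge0//.
    by apply: sumr_ge0 => i _; apply: sumr_ge0 => j _; exact: sqr_ge0.
  by move: hcz; lra.
have main (prof : 'I_N -> R) (i0 : 'I_N) : (forall j, A (prof j)) ->
    (forall j, j != i0 -> prof j = al j) ->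
    exists z' : 'I_N -> {mfun Omega >-> R}, is_state P b W xi prof z' /\
      `|Jt b f (prof i0) (joint_law P (xi i0) (z' i0)) - J (v i0) (prof i0)| <=
      lt * Num.sqrt mm.
  move=> pA pal.
  have hlip' j x y : `|b (prof j) x - b (prof j) y| ^+ 2 <= cz * `|x - y| ^+ 2.
    exact: (lipschitz_snd hbLip x y (pA j)).
  have [z' [sz' z'E]] := is_state_exists hcz hlip' (fun j x => hbbound x (pA j)) r1 xi2.
  exists z'; split => //.
  have z'2 i : (z' i : Omega -> R) \in Lfun P 2%:E by case: sz' => -[].
  have dev := @deviation_bound _ _ _ P N W (fun j => b (prof j)) B v xi z' i0 cz c0
    tau K delta (4 * g) zeta rho sn q N0 hcz (ltW hc0) tau0 z0 hlip'
    (fun j x => hbbound x (pA j)) Bc _ vE z'E z'2 WK Wdelta WT Wrho rho1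
    (fun i => (noise_small i).1) (fun i => (noise_small i).2) q0 qge i0.
  have {}dev : \int[P]_w' ((z' i0 w' - v i0) ^+ 2) <= mm.
    by apply: dev => j ji; rewrite pal.
  have law (C : set R) : measurable C -> distribution P (xi i0) C = mu0 C.
    by have [l _] := hxi; exact: l.
  have L2 : P.-integrable setT (EFin \o (fun w' => ((cst (v i0) : {mfun Omega >-> R}) w' - z' i0 w') ^+ 2)).
    have /Lfun2P[] // : (fun w' => v i0 + (- 1) * z' i0 w') \in Lfun P 2%:E.
      apply: Lfun2_addr; last exact: Lfun2_mulrl.
      apply: (@Lfun2_bounded _ _ _ _ _ `|v i0|) => //.
      by rewrite [ltLHS]probability_setT ltry.
    by move=> _; apply: eq_integrable => // w' _ /=; rewrite mulN1r.
  have := Jt_joint_law_close law hlt hJtLip (pA i0) L2.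
  rewrite (Jt_law_cst law) => /le_trans; apply.
  apply: ler_wpM2l => //; apply: ler_wsqrtr; apply: le_trans dev.
  rewrite le_eqVlt; apply/orP; left; apply/eqP; apply: eq_Rintegral => w' _ /=.
  by rewrite -sqrrN opprB.
split=> [//|i beta Abeta].
have [z1 [sz1 h1]] := main al i alA (fun j _ => erefl).
have pA j : A (replace al i beta j) by rewrite /replace; case: ifP.
have pal j : j != i -> replace al i beta j = al j.
  by rewrite /replace => /negbTE ->.
have [z2 [sz2 h2]] := main (replace al i beta) i pA pal.
exists z1, z2; split => //.
rewrite /replace eqxx in h2.
have := Jopt i _ Abeta; move: h1 h2; rewrite !ler_norml.
rewrite /nash_error -/mm -/eta; move=> /andP[? ?] /andP[? ?] ?; lra.
Qed.

End FixedSize.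

Theorem theorem4p9 (R : realType)
  (A : set R) (mu0 : probability R R)
  (b : R -> R -> R) (f : R -> R -> R -> R)
  (c_alpha c_z l_c l_J lt_J c_0 : R)
  (hA0 : A !=set0) (hAclosed : closed A)
  (hAconvex : convex_set (A : set (convex_lmodType R^o)))
  (hAbounded : bounded_set A)
  (hmean : (\int[mu0]_x x%:E = 0)%E)
  (hJt : forall alpha nu, A alpha -> calK mu0 nu ->
     nu.-integrable setT (EFin \o cost_integrand b f alpha))
  (hc_alpha : 0 <= c_alpha) (hc_z : 0 <= c_z) (hl_c : 0 < l_c)
  (hl_J : 0 <= l_J) (hlt_J : 0 <= lt_J) (hc_0 : 0 < c_0)
  (hbLip : forall alpha alpha' z z', A alpha -> A alpha' ->
     `|b alpha z - b alpha' z'| ^+ 2 <=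
       c_alpha * `|alpha - alpha'| ^+ 2 + c_z * `|z - z'| ^+ 2)
  (hvar : (\int[mu0]_x (x ^+ 2)%:E < +oo)%E)
  (hJtLip : forall alpha nu nu', A alpha -> calK mu0 nu -> calK mu0 nu' ->
     (`|Jt b f alpha nu' - Jt b f alpha nu|%:E <= lt_J%:E * W2 nu nu')%E)
  (dJ : R -> R -> R)
  (hJC1 : forall z, C1_on A (Jc b f mu0 ^~ z) (dJ ^~ z))
  (hJconvex : forall (alpha alpha' z eps : R), A alpha -> A alpha' -> 0 <= eps <= 1 ->
     Jc b f mu0 (eps * alpha + (1 - eps) * alpha') z <=
       eps * Jc b f mu0 alpha z + (1 - eps) * Jc b f mu0 alpha' z
       - l_c / 2 * eps * (1 - eps) * `|alpha - alpha'| ^+ 2)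
  (hdJLip : forall alpha z z', A alpha ->
     `|dJ alpha z' - dJ alpha z| <= l_J * `|z' - z|)
  (hbbound : forall alpha z, A alpha -> `|b alpha z| <= c_0)
  (W : forall N : nat, 'M[R]_N)
  (hWsym : forall N, (0 < N)%N -> (W N)^T = W N)
  (zetat : R)
  (hWrow : forall N, (0 < N)%N -> forall i : 'I_N,
     (N%:R ^+ 2)^-1 * \sum_(j < N) W N i j ^+ 2 <= zetat)
  (w : R * R -> R) (hw : graphon w) (zeta : R)
  (hw2 : ((Num.sqrt (2 * c_z))%:E * normL2II w < 1)%E)
  (hwop : ((Num.sqrt c_z)%:E * opnorm w < 1)%E)
  (hwrow : (ereal_sup [set normL2I (fun y => w (x, y)) | x in @I01 R]
              <= zeta%:E)%E)
  (hw2cvg : normL2II (Psi (W N)) @[N --> \oo] --> normL2II w)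
  (hwopcvg : opnorm (Psi (W N)) @[N --> \oo] --> opnorm w)
  (gamma : nat -> R)
  (hcut : forall N, (0 < N)%N ->
     (cutnorm (fun p => Psi (W N) p - w p)%R <= (gamma N)%:E)%E)
  (hgamma : N%:R * gamma N @[N --> \oo] --> 0)
  (alphahat : R -> R) (hnash : graphon_nash A b f mu0 w alphahat)
  (d : nat -> measure_display) (Omega : forall N, measurableType (d N))
  (P : forall N, probability (Omega N) R)
  (xi : forall N, 'I_N -> {mfun Omega N >-> R})
  (hxi : forall N, (0 < N)%N -> iid (P N) mu0 (xi N)) :
  exists eps : nat -> R,
    [/\ forall N, 0 <= eps N,
        eps N @[N --> \oo] --> 0 &
        \forall N \near \oo,
          eps_nash (P N) A b f (W N) (xi N) (eps N) (muN alphahat)].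
Proof.
have [rho rho1 Wrho] := eventual_contraction hc_z hw hw2 hw2cvg.
pose s2 := \int[mu0]_x (x ^+ 2).
exists (fun N => nash_error c_alpha c_z l_c lt_J c_0 zeta rho s2
  (N%:R * gamma N) N%:R^-1); split.
- move=> N; have g0 : 0 <= N%:R * gamma N.
    have [->|] := posnP N; first by rewrite mul0r.
    by move=> N0; rewrite mulr_ge0// (gamma_ge0 hw N0 (hcut _ N0)).
  have c00 : 0 <= c_0 by exact: ltW.
  apply: addr_ge0; first by rewrite !mulr_ge0 ?sqrtr_ge0.
  apply: addr_ge0; last by rewrite invr_ge0.
  by apply: mulr_ge0; [exact: mulr_ge0|apply: mulr_ge0 => //; exact: mulr_ge0].
- exact: (cvg_nash_error c_alpha c_z l_c lt_J c_0 zeta rho s2 hgamma (@cvg_natV R)).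
apply: filterS2 (nbhs_infty_gt 0) Wrho => N N0 WN.
exact: (fixed_size_eps_nash hA0 hAclosed hAconvex hAbounded hmean hc_alpha hc_z
  hl_c hlt_J hc_0 hbLip hvar hJtLip hJC1 hJconvex hbbound hw hwrow hnash N0
  (hcut _ N0) (hxi _ N0) WN rho1).
Qed.
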